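(* The twelve Reifenberg-type properties $wj$, $w\rho j$, $w\rho_0 j$, $w\delta j$, $w\rho\delta j$, $w\rho_0\delta j$, $sj$, $s\rho j$, $s\rho_0 j$, $s\delta j$, $s\rho\delta j$, $s\rho_0\delta j$ (defined in the context) satisfy the following classification with respect to the four questions below. For a set $P\subset\mathbb{R}^n$ having the property in question (in dimension $j\le n$), does it follow that: (1) $\dim_{\mathcal H}P\le j$? (2)(a) $P$ has weakly locally finite $\mathcal H^j$-measure? (2)(b) $P$ has strongly locally finite $\mathcal H^j$-measure? (3) $P$ is countably $j$-rectifiable? The answers, listed in the order (1); (2)(a), (2)(b); (3), are: - $wj$: No; No, No; No. - $w\rho j$: No; No, No; No. - $w\rho_0 j$: No; No, No; No. - $w\delta j$: Yes; No, No; No. - $w\rho\delta j$: Yes; No, No; No. - $w\rho_0\delta j$: Yes; Yes, Yes; Yes. - $sj$: Yes; No, No; Yes. - $s\rho j$: Yes; Yes, No; Yes. - $s\rho_0 j$: Yes; Yes, Yes; Yes. - $s\delta j$: Yes; No, No; Yes. - $s\rho\delta j$: Yes; Yes, No; Yes. - $s\rho_0\delta j$: Yes; Yes, Yes; Yes. Here the meaning of the answers is as follows. For the six properties without the letter $\delta$ in their name, the property is taken with respect to a fixed parameter $\gamma\in(0,1)$, and the answer holds for every such $\gamma$. ''Yes'' means: for all $j,n\in\mathbb{N}$ with $j\le n$ (and all $\gamma\in(0,1)$ where applicable), every $P\subset\mathbb{R}^n$ with the property has the stated regularity. ''No'' means that (for every $\gamma\in(0,1)$ where applicable) the implication does not hold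 for all $j$: there exist $j\le n$ and a set $P\subset\mathbb{R}^n$ with the property that fails the stated regularity.
   Context: Notation. $B_r(x)$ is the open ball in $\mathbb{R}^n$; for $L\subset\mathbb{R}^n$ and $r>0$, $L^{r}=\{x\in\mathbb{R}^n: d(x,L)<r\}$. $G(n,j)$ is the set of $j$-dimensional linear subspaces of $\mathbb{R}^n$ and $G_y(n,j)=\{G+y:G\in G(n,j)\}$. $\mathcal H^s$ is $s$-dimensional Hausdorff (outer) measure and $\dim_{\mathcal H}$ is Hausdorff dimension. Properties of a set $A\subset\mathbb{R}^n$, with respect to a parameter $\gamma\in(0,1)$: - $wj$ property: for all $y\in A$ there is $\rho_y>0$ such that for all $\rho\in(0,\rho_y]$ there is $L_{y,\rho}\in G_y(n,j)$ with $B_\rho(y)\cap A\subset L_{y,\rho}^{\gamma\rho}$. - $w\rho j$ property: for all $y\in A$ there is $\rho_y>0$ such that for all $\rho\in(0,\rho_y]$ and all $x\in B_{\rho_y}(y)\cap A$ there is $L_{x,\rho}\in G_x(n,j)$ with $B_\rho(x)\cap A\subset L_{x,\rho}^{\gamma\rho}$. - $w\rho_0 j$ property: there is $\rho_0>0$ such that $A$ is contained in some ball of radius $\rho_0$ and for every $y\in A$ and $\rho\in(0,\rho_0]$ there is $L_{y,\rho}\in G_y(n,j)$ with $B_\rho(y)\cap A\subset L_{y,\rho}^{\gamma\rho}$. - $sj$ property: for all $y\in A$ there are $\rho_y>0$ and $L_y\in G_y(n,j)$ such that for all $\rho\in(0,\rho_y]$, $B_\rho(y)\cap A\subset L_y^{\gamma\rho}$.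 - $s\rho j$ property: for all $y\in A$ there are $\rho_y>0$ and $L_y\in G(n,j)$ such that for all $x\in B_{\rho_y}(y)\cap A$ and all $\rho\in(0,\rho_y]$, $B_\rho(x)\cap A\subset(L_y+x)^{\gamma\rho}$. - $s\rho_0 j$ property: there is $\rho_0>0$ such that $A$ is contained in some ball of radius $\rho_0$ and there is $L\in G(n,j)$ such that for all $x\in A$ and $\rho\in(0,\rho_0]$, $B_\rho(x)\cap A\subset(L+x)^{\gamma\rho}$. The properties $w\delta j$, $w\rho\delta j$, $w\rho_0\delta j$, $s\delta j$, $s\rho\delta j$, $s\rho_0\delta j$ (no parameter) mean that $A$ has respectively the $wj$, $w\rho j$, $w\rho_0 j$, $sj$, $s\rho j$, $s\rho_0 j$ property with respect to every $\gamma\in(0,1)$ (the radii and planes may depend on $\gamma$). Regularity notions. $A\subset\mathbb{R}^n$ has strongly locally finite $\mathcal H^j$-measure if $\mathcal H^j(K\cap A)<\infty$ for every compact $K\subset\mathbb{R}^n$. It has weakly locally finite $\mathcal H^j$-measure if for every $y\in A$ there is $\rho_y>0$ with $\mathcal H^j(B_{\rho_y}(y)\cap A)<\infty$. It is (countably) $j$-rectifiable if there are $M_0\subset\mathbb{R}^n$ with $\mathcal H^j(M_0)=0$ and Lipschitz maps $f_i:\mathbb{R}^j\to\mathbb{R}^n$, $i\in\mathbb{N}$, with $A\subset M_0\cup\bigcup_{i=1}^\infty f_i(\mathbb{R}^j)$ (no local finiteness of measure required). *)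

(* Defs.v *)
From HB Require Import structures.
From mathcomp Require Import all_boot all_order all_algebra.
From mathcomp Require Import all_classical all_reals all_analysis.
Import Order.TTheory GRing.Theory Num.Theory.
Import numFieldNormedType.Exports.

Set Implicit Arguments.
Unset Strict Implicit.
Unset Printing Implicit Defensive.

Local Open Scope classical_set_scope.
Local Open Scope ring_scope.

(* R^n is 'rV[R]_n. The library's norm on 'rV[R]_n is the sup norm, so the
   Euclidean metric is introduced here. Both norms induce the topology of
   'rV[R]_n, hence [compact] is the usual notion. *)
Definition enorm (R : realType) (n : nat) (x : 'rV[R]_n) : R :=
  Num.sqrt (\sum_(i < n) x 0 i ^+ 2).

Definition eball (R : realType) (n : nat) (x : 'rV[R]_n) (r : R)
  : set 'rV[R]_n := [set y | enorm (y - x) < r].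

Definition edist (R : realType) (n : nat) (x : 'rV[R]_n) (L : set 'rV[R]_n)
  : \bar R := ereal_inf [set (enorm (x - l))%:E | l in L].

(* L^r *)
Definition nbhd_of (R : realType) (n : nat) (L : set 'rV[R]_n) (r : R)
  : set 'rV[R]_n := [set x | (edist x L < r%:E)%E].

(* G(n, j) *)
Definition Gr (R : realType) (n j : nat) : set {vspace 'rV[R]_n} :=
  [set L | \dim L = j].
Arguments Gr : clear implicits.

(* L + y; the elements of G_y(n, j) are the sets [translate L y], L \in G(n, j) *)
Definition translate (R : realType) (n : nat) (L : {vspace 'rV[R]_n})
  (y : 'rV[R]_n) : set 'rV[R]_n := [set l + y | l in [set v | v \in L]].

(* -oo on the empty set *)
Definition ediam (R : realType) (n : nat) (F : set 'rV[R]_n) : \bar R :=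
  ereal_sup [set (enorm (z.1 - z.2))%:E | z in F `*` F].

(* diam(F)^s, with diam(set0)^s = 0 for every s and 0^0 = 1 on nonempty sets,
   so that the 0-dimensional Hausdorff measure is the counting measure. *)
Definition diam_pow (R : realType) (n : nat) (s : R) (F : set 'rV[R]_n)
  : \bar R := if F == set0 then 0%E else (ediam F `^ s)%E.

Definition hausdorff_pre (R : realType) (n : nat) (s delta : R)
  (A : set 'rV[R]_n) : \bar R :=
  ereal_inf [set (\sum_(0 <= k <oo) diam_pow s (F k))%E |
    F in [set F : nat -> set 'rV[R]_n |
      A `<=` \bigcup_k F k /\ forall k, (ediam (F k) <= delta%:E)%E]].

(* Without the normalising factor of diam^s, which is a positive finite constant
   and so affects neither finiteness nor vanishing. *)
Definition hausdorff (R : realType) (n : nat) (s : R) (A : set 'rV[R]_n)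
  : \bar R :=
  ereal_sup [set hausdorff_pre s delta A | delta in [set d : R | 0 < d]].

Definition hausdorff_dim (R : realType) (n : nat) (A : set 'rV[R]_n) : \bar R :=
  ereal_inf [set s%:E | s in [set s : R | 0 <= s /\ hausdorff s A = 0%E]].

(* A property of subsets of R^n in dimension j. *)
Definition set_prop (R : realType) : Type :=
  forall n j : nat, set 'rV[R]_n -> Prop.

Section Reifenberg.
Variables (R : realType) (gamma : R) (n j : nat) (A : set 'rV[R]_n).

Definition wj : Prop :=
  forall y, A y -> exists2 rho_y : R, 0 < rho_y &
    forall rho : R, 0 < rho <= rho_y -> exists2 L, Gr R n j L &
      eball y rho `&` A `<=` nbhd_of (translate L y) (gamma * rho).

Definition wrhoj : Prop :=
  forall y, A y -> exists2 rho_y : R, 0 < rho_y &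
    forall rho : R, 0 < rho <= rho_y -> forall x, (eball y rho_y `&` A) x ->
      exists2 L, Gr R n j L &
        eball x rho `&` A `<=` nbhd_of (translate L x) (gamma * rho).

Definition wrho0j : Prop :=
  exists rho0 : R, [/\ 0 < rho0, (exists z, A `<=` eball z rho0) &
    forall y, A y -> forall rho : R, 0 < rho <= rho0 -> exists2 L, Gr R n j L &
      eball y rho `&` A `<=` nbhd_of (translate L y) (gamma * rho)].

Definition sj : Prop :=
  forall y, A y -> exists2 rho_y : R, 0 < rho_y & exists2 L, Gr R n j L &
    forall rho : R, 0 < rho <= rho_y ->
      eball y rho `&` A `<=` nbhd_of (translate L y) (gamma * rho).

Definition srhoj : Prop :=
  forall y, A y -> exists2 rho_y : R, 0 < rho_y & exists2 L, Gr R n j L &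
    forall x, (eball y rho_y `&` A) x -> forall rho : R, 0 < rho <= rho_y ->
      eball x rho `&` A `<=` nbhd_of (translate L x) (gamma * rho).

Definition srho0j : Prop :=
  exists rho0 : R, [/\ 0 < rho0, (exists z, A `<=` eball z rho0) &
    exists2 L, Gr R n j L &
      forall x, A x -> forall rho : R, 0 < rho <= rho0 ->
        eball x rho `&` A `<=` nbhd_of (translate L x) (gamma * rho)].

End Reifenberg.
Arguments wj {R} gamma n j A.
Arguments wrhoj {R} gamma n j A.
Arguments wrho0j {R} gamma n j A.
Arguments sj {R} gamma n j A.
Arguments srhoj {R} gamma n j A.
Arguments srho0j {R} gamma n j A.

(* The delta version of a property with parameter. *)
Definition for_all_gamma (R : realType) (P : R -> set_prop R) : set_prop R :=
  fun n j A => forall gamma : R, 0 < gamma < 1 -> P gamma n j A.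

Definition wdeltaj (R : realType) : set_prop R := for_all_gamma (@wj R).
Definition wrhodeltaj (R : realType) : set_prop R := for_all_gamma (@wrhoj R).
Definition wrho0deltaj (R : realType) : set_prop R := for_all_gamma (@wrho0j R).
Definition sdeltaj (R : realType) : set_prop R := for_all_gamma (@sj R).
Definition srhodeltaj (R : realType) : set_prop R := for_all_gamma (@srhoj R).
Definition srho0deltaj (R : realType) : set_prop R := for_all_gamma (@srho0j R).
Arguments wdeltaj : clear implicits.
Arguments wrhodeltaj : clear implicits.
Arguments wrho0deltaj : clear implicits.
Arguments sdeltaj : clear implicits.
Arguments srhodeltaj : clear implicits.
Arguments srho0deltaj : clear implicits.

Definition dim_le (R : realType) : set_prop R :=
  fun n j A => (hausdorff_dim A <= (j%:R : R)%:E)%E.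

Definition weakly_locally_finite (R : realType) : set_prop R :=
  fun n j A => forall y, A y -> exists2 rho_y : R, 0 < rho_y &
    (hausdorff j%:R (eball y rho_y `&` A) < +oo)%E.

Definition strongly_locally_finite (R : realType) : set_prop R :=
  fun n j A => forall K : set 'rV[R]_n, compact K ->
    (hausdorff j%:R (K `&` A) < +oo)%E.

Definition elipschitz (R : realType) (m n : nat) (f : 'rV[R]_m -> 'rV[R]_n)
  : Prop := exists C : R, forall x y, enorm (f x - f y) <= C * enorm (x - y).

Definition rectifiable (R : realType) : set_prop R :=
  fun n j A => exists (M0 : set 'rV[R]_n) (f : nat -> 'rV[R]_j -> 'rV[R]_n),
    [/\ hausdorff j%:R M0 = 0%E, (forall i, elipschitz (f i)) &
        A `<=` M0 `|` \bigcup_i range (f i)].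
Arguments dim_le : clear implicits.
Arguments weakly_locally_finite : clear implicits.
Arguments strongly_locally_finite : clear implicits.
Arguments rectifiable : clear implicits.

Inductive answer := Yes | No.

(* Positive answers include j = 0, while the counterexamples must have j > 0, so
   that the classification holds whether or not 0 is a natural number. *)
Definition answers (R : realType) (P Q : set_prop R) (a : answer) : Prop :=
  match a with
  | Yes => forall n j : nat, (j <= n)%N ->
      forall A : set 'rV[R]_n, P n j A -> Q n j A
  | No => exists n j : nat, (0 < j <= n)%N /\
      exists A : set 'rV[R]_n, P n j A /\ ~ Q n j A
  end.

Definition classified (R : realType) (P : set_prop R) (a1 a2a a2b a3 : answer)
  : Prop :=
  [/\ answers P (dim_le R) a1,
      answers P (weakly_locally_finite R) a2a,
      answers P (strongly_locally_finite R) a2b &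
      answers P (rectifiable R) a3].

(* Main.v *)
Require Import Defs.
From mathcomp Require Import all_boot all_order all_algebra.
From mathcomp Require Import all_classical all_reals all_analysis.
From mathcomp Require Import ring lra zify.
Import Order.TTheory GRing.Theory Num.Theory.
Import numFieldNormedType.Exports.

(** Positive answers.  They rest on one notion, [minkowski_finite j E]: for
    every M, at most K M^j sets of diameter K / M cover E.  It bounds the
    j-dimensional Hausdorff measure, kills every s-dimensional one with s > j,
    and holds for bounded sets on which some linear map to R^j shrinks
    distances by at most a constant factor ([colipschitz]).  The property sj says that all of A near
    y lies in a cone around L_y, so the projection to L_y does not shrink
    distances from y by more than a factor (1 - gamma) / 2 ([flat_cone]).
    Replacing the projection by a rational matrix close to it and localising to
    a ball of a countable base, one cuts A into countably many pieces on which
    a single matrix is co-Lipschitz ([sj_pieces]); each is contained in the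
    image of a Lipschitz map, by McShane extension.  When the plane is locally
    uniform the pieces are balls, which gives local finiteness.

    In w rho_0 delta j the radius depends on gamma, but A fits in a ball of
    radius rho_0; hence every rho_0 exceeds half the distance between two
    points of A, and A is gamma-flat for all gamma at one common scale.  At that
    scale A lies exactly in planes, and all four answers are positive.  For
    w delta j only the dimension is bounded: if A is 1/M-flat, a piece of
    diameter d is covered by M^j pieces of diameter K d / M with K depending on
    j only, and iterating makes the s-dimensional sums decay geometrically as
    soon as M^j (K / M)^s < 1 ([wj_covered], [wdeltaj_dim]).

    Negative answers for the s-properties.  These and the next examples are
    plane sets, with j = 1.  Take the segments of height 4^-k
    over 2^-k <= x <= 1, with or without their limit point 0.  They are locally
    lines, and tangent to the horizontal axis at 0, while infinitely many of
    them, of length bounded below, meet each neighbourhood of 0 ([stripes]).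

    Negative answers for the w-properties.  Take a Koch curve whose k-th
    generator tilts the middle edges by about 2 tau_k; its edges of level m have
    length 4^-m (1 + tau_0^2) ... (1 + tau_{m-1}^2).  At the scale of these edges
    the curve is a line up to O(tau) ([curve_est]), so it is gamma-flat if tau
    is small.  For constant tau the length grows geometrically, the inverse of
    the parametrisation is Hoelder with an exponent above 1, and the dimension
    exceeds 1.  For tau_k of order (k + 1)^(-1/2) the tilts vanish but the length
    still diverges, because the harmonic series does; the inverse of the
    parametrisation is then infinitesimally Lipschitz ([expanding]), which
    leaves no room for a set of sigma-finite length of positive Lebesgue
    parameter measure.  The corners created at level k never open up at finer
    levels, so they would spoil vanishing flatness; therefore only parameters at
    distance at least 4^(-2k-2) from the corners of every level k are kept
    ([junction_free]).  They have positive measure, and near such a parameter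
    the levels of the visible corners tend to infinity. *)

Set Implicit Arguments.
Unset Strict Implicit.
Unset Printing Implicit Defensive.

Local Open Scope classical_set_scope.
Local Open Scope ring_scope.

(** * The Euclidean norm *)

Section Euclid.
Variable R : realType.
Implicit Types n m j : nat.

Definition dot n (u v : 'rV[R]_n) : R := \sum_i u 0 i * v 0 i.

Lemma dotC n (u v : 'rV[R]_n) : dot u v = dot v u.
Proof. by apply: eq_bigr => i _; rewrite mulrC. Qed.

Lemma dotDl n (u v w : 'rV[R]_n) : dot (u + v) w = dot u w + dot v w.
Proof. by rewrite -big_split; apply: eq_bigr => i _; rewrite mxE mulrDl. Qed.

Lemma dotZl n a (u w : 'rV[R]_n) : dot (a *: u) w = a * dot u w.
Proof. by rewrite mulr_sumr; apply: eq_bigr => i _; rewrite mxE mulrA. Qed.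

Lemma dotDr n (u v w : 'rV[R]_n) : dot u (v + w) = dot u v + dot u w.
Proof. by rewrite dotC dotDl !(dotC u). Qed.

Lemma dotNl n (u w : 'rV[R]_n) : dot (- u) w = - dot u w.
Proof. by rewrite -scaleN1r dotZl mulN1r. Qed.

Lemma dotE n (u v : 'rV[R]_n) : dot u v = (u *m v^T) 0 0.
Proof. by rewrite mxE; apply: eq_bigr => i _; rewrite mxE. Qed.

Lemma dot_adjoint n m (u : 'rV[R]_n) (B : 'M[R]_(n, m)) (w : 'rV[R]_m) :
  dot (u *m B) w = dot u (w *m B^T).
Proof. by rewrite !dotE trmx_mul trmxK mulmxA. Qed.

Lemma dot_ge0 n (u : 'rV[R]_n) : 0 <= dot u u.
Proof. by apply: sumr_ge0 => i _; rewrite -expr2 sqr_ge0. Qed.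

Lemma dot_eq0 n (u : 'rV[R]_n) : dot u u = 0 -> u = 0.
Proof.
move=> /psumr_eq0P u0; apply/rowP => i; rewrite mxE.
apply/eqP; rewrite -sqrf_eq0 expr2; apply/eqP/u0 => // k _.
by rewrite -expr2 sqr_ge0.
Qed.

Lemma enorm_sqr n (u : 'rV[R]_n) : enorm u ^+ 2 = dot u u.
Proof.
rewrite sqr_sqrtr; last by apply: sumr_ge0 => i _; rewrite sqr_ge0.
by apply: eq_bigr => i _; rewrite expr2.
Qed.

Lemma enorm_ge0 n (u : 'rV[R]_n) : 0 <= enorm u.
Proof. exact: sqrtr_ge0. Qed.

Lemma enormP n (u : 'rV[R]_n) c : 0 <= c -> (enorm u <= c) = (dot u u <= c ^+ 2).
Proof. by move=> c0; rewrite -enorm_sqr ler_sqr ?nnegrE ?enorm_ge0. Qed.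

Lemma enorm0 n : enorm (0 : 'rV[R]_n) = 0.
Proof.
by apply/eqP; rewrite -sqrf_eq0 enorm_sqr /dot big1 // => i _; rewrite mxE mul0r.
Qed.

Lemma enorm0_eq n (u : 'rV[R]_n) : enorm u = 0 -> u = 0.
Proof. by move=> u0; apply: dot_eq0; rewrite -enorm_sqr u0 expr0n. Qed.

Lemma enorm_gt0 n (u : 'rV[R]_n) : u != 0 -> 0 < enorm u.
Proof.
by move=> u0; rewrite lt_def enorm_ge0 andbT; apply: contra_neq u0 => /enorm0_eq.
Qed.

Lemma enormZ n a (u : 'rV[R]_n) : enorm (a *: u) = `|a| * enorm u.
Proof.
apply/eqP; rewrite -(@eqrXn2 _ 2) ?nnegrE ?mulr_ge0 ?enorm_ge0 ?normr_ge0//.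
by rewrite exprMn !enorm_sqr dotZl dotC dotZl mulrA -expr2 real_normK ?num_real.
Qed.

Lemma enormN n (u : 'rV[R]_n) : enorm (- u) = enorm u.
Proof. by rewrite -scaleN1r enormZ normrN1 mul1r. Qed.

Lemma enormB n (u v : 'rV[R]_n) : enorm (u - v) = enorm (v - u).
Proof. by rewrite -enormN opprB. Qed.

(** Expand the square of the vector |v| u - |u| v. *)
Lemma cauchy_schwarz n (u v : 'rV[R]_n) : dot u v <= enorm u * enorm v.
Proof.
have [->|u0] := eqVneq u 0.
  by rewrite enorm0 mul0r /dot big1 // => i _; rewrite mxE mul0r.
have [->|v0] := eqVneq v 0.
  by rewrite enorm0 mulr0 /dot big1 // => i _; rewrite mxE mulr0.
have a0 := enorm_gt0 u0; have b0 := enorm_gt0 v0.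
have := dot_ge0 (enorm v *: u - enorm u *: v).
rewrite !(dotDl, dotNl, dotZl) ![dot _ (_ - _)]dotC !(dotDl, dotNl, dotZl).
rewrite (dotC v u) -!enorm_sqr.
set a := enorm u; set b := enorm v; set d := dot u v => H.
have : 0 <= 2 * (a * b) * (a * b - d) by move: H; lra.
by rewrite pmulr_rge0 ?subr_ge0// !mulr_gt0.
Qed.

Lemma enormD n (u v : 'rV[R]_n) : enorm (u + v) <= enorm u + enorm v.
Proof.
rewrite enormP ?addr_ge0 ?enorm_ge0// dotDl !dotDr.
by rewrite (dotC v u) sqrrD -!enorm_sqr; have := cauchy_schwarz u v; lra.
Qed.

Lemma enorm_triangle n (v u w : 'rV[R]_n) :
  enorm (u - w) <= enorm (u - v) + enorm (v - w).
Proof. by apply: le_trans (enormD _ _); rewrite addrA subrK. Qed.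

Lemma enorm_sub n (u v : 'rV[R]_n) : enorm u - enorm v <= enorm (u - v).
Proof. by rewrite lerBlDr; apply: le_trans (enormD _ _); rewrite subrK. Qed.

Lemma enorm_coord n (u : 'rV[R]_n) i : `|u 0 i| <= enorm u.
Proof.
rewrite -ler_sqr ?nnegrE ?enorm_ge0// real_normK ?num_real// enorm_sqr.
rewrite /dot (bigD1 i)//= -expr2 lerDl.
by apply: sumr_ge0 => k _; rewrite -expr2 sqr_ge0.
Qed.

Lemma enorm_sum n (I : Type) (s : seq I) (P : pred I) (F : I -> 'rV[R]_n) :
  enorm (\sum_(i <- s | P i) F i) <= \sum_(i <- s | P i) enorm (F i).
Proof.
elim/big_rec2: _ => [|i y x _ h]; first by rewrite enorm0.
by apply: le_trans (enormD _ _) _; rewrite lerD2l.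
Qed.

Lemma enorm_delta n (i : 'I_n) : enorm (delta_mx 0 i : 'rV[R]_n) = 1.
Proof.
apply/eqP; rewrite -(@eqrXn2 _ 2) ?enorm_ge0// enorm_sqr /dot (bigD1 i)//=.
by rewrite mxE !eqxx mulr1 big1 ?addr0 ?expr1n// => k ki; rewrite !mxE (negbTE ki) andbF mul0r.
Qed.

Lemma enorm_le_coords n (u : 'rV[R]_n) c : (forall i, `|u 0 i| <= c) ->
  enorm u <= n%:R * c.
Proof.
move=> uc; rewrite [u in enorm u]row_sum_delta.
apply: le_trans (enorm_sum _ _ _) _.
rewrite mulr_natl -[n in _ *+ n]card_ord -sumr_const; apply: ler_sum => i _.
by rewrite enormZ enorm_delta mulr1.
Qed.

Lemma enorm_mulmx n m (B : 'M[R]_(n, m)) :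
  exists2 C, 0 < C & forall u : 'rV_n, enorm (u *m B) <= C * enorm u.
Proof.
exists (1 + \sum_i enorm (row i B)) => [|u].
  by rewrite ltr_pwDl//; apply: sumr_ge0 => i _; exact: enorm_ge0.
rewrite mulmx_sum_row mulrDl mul1r; apply: le_trans (enorm_sum _ _ _) _.
rewrite mulr_suml ler_wpDl ?enorm_ge0//; apply: ler_sum => i _.
by rewrite enormZ mulrC ler_wpM2l ?enorm_ge0 ?enorm_coord.
Qed.

(** The factor is crude but linear in e, so that it can be made small. *)
Lemma enorm_mulmx_small n m (B : 'M[R]_(n, m)) e : (forall i k, `|B i k| <= e) ->
  forall u : 'rV_n, enorm (u *m B) <= (n%:R * (m%:R * e)) * enorm u.
Proof.
move=> Be u; rewrite mulmx_sum_row; apply: le_trans (enorm_sum _ _ _) _.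
rewrite -mulrA mulr_natl -[n in _ *+ n]card_ord -sumr_const; apply: ler_sum => i _.
rewrite enormZ mulrC ler_pM ?enorm_ge0 ?enorm_coord//.
by apply: enorm_le_coords => k; rewrite mxE.
Qed.

End Euclid.

(** * Planes and orthonormal bases *)

Section Planes.
Variable R : realType.
Implicit Types n m j : nat.

(** Gram-Schmidt by induction on the dimension: split off a unit vector u of L
    and continue in the intersection of L with the kernel of the product
    with u.  With B as below, v |-> v B^T B is the orthogonal projection on L,
    so that the rest of the development handles matrices instead of subspaces. *)
Lemma orthonormal_basis n j (L : {vspace 'rV[R]_n}) : \dim L = j ->
  exists B : 'M[R]_(j, n), [/\ B *m B^T = 1%:M,
    forall v, v \in L -> v *m B^T *m B = v & forall w, w *m B \in L].
Proof.
elim: j L => [|j IH] L dL.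
  exists 0; split=> [|v|w].
  - by rewrite [RHS]flatmx0 [LHS]flatmx0.
  - by move/eqP: dL; rewrite dimv_eq0 => /eqP -> /[!memv0] /eqP ->; rewrite mulmx0.
  - by rewrite mulmx0 mem0v.
set v := vpick L; have v0 : v != 0 by rewrite vpick0 -dimv_eq0 dL.
set u := (enorm v)^-1 *: v.
have uL : u \in L by rewrite memvZ// memv_pick.
have uu : u *m u^T = 1%:M.
  apply/matrixP => a b; rewrite !ord1 -dotE mxE eqxx -enorm_sqr enormZ.
  by rewrite ger0_norm ?invr_ge0 ?enorm_ge0// mulVf ?expr1n// gt_eqF ?enorm_gt0.
pose f := linfun (mulmxr u^T : 'rV[R]_n -> 'rV[R]_1).
have fE x : f x = x *m u^T by rewrite lfunE.
have dL' : \dim (L :&: lker f)%VS = j.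
  suff df : \dim (f @: L)%VS = 1 by have := limg_ker_dim f L; rewrite df dL addn1 => -[].
  apply/eqP; rewrite eqn_leq; apply/andP; split.
    by have := dimvS (subvf (f @: L)%VS); rewrite dimvf.
  rewrite lt0n dimv_eq0; apply/eqP => fL0.
  have : f u \in 0%VS by rewrite -fL0 memv_img.
  by rewrite memv0 fE uu => /eqP/matrixP/(_ 0 0)/eqP; rewrite !mxE eqxx oner_eq0.
have [B [BB LB BL]] := IH _ dL'.
have Bu : B *m u^T = 0.
  apply/row_matrixP => i; rewrite row_mul row0 rowE.
  by have := BL (delta_mx 0 i); rewrite memv_cap memv_ker fE => /andP[_ /eqP].
have uB : u *m B^T = 0 by apply: trmx_inj; rewrite trmx_mul trmxK Bu trmx0.
suff [C CP] : exists C : 'M[R]_(1 + j, n), [/\ C *m C^T = 1%:M,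
    forall v, v \in L -> v *m C^T *m C = v & forall w, w *m C \in L] by exists C.
exists (col_mx u B); split => [|x xL|w].
- by rewrite tr_col_mx mul_col_row uu uB Bu BB -scalar_mx_block.
- rewrite tr_col_mx mul_mx_row mul_row_col.
  have : x - x *m u^T *m u \in (L :&: lker f)%VS.
    rewrite memv_cap memvB//=; last first.
      by rewrite [x *m _]mx11_scalar mul_scalar_mx memvZ.
    by rewrite memv_ker fE mulmxBl -[_ *m u *m _]mulmxA uu mulmx1 subrr.
  by move=> /LB; rewrite mulmxBl -[_ *m u *m _]mulmxA uB mulmx0 subr0 => ->; rewrite addrC subrK.
- rewrite -[w]hsubmxK mul_row_col memvD//.
    by rewrite [lsubmx _]mx11_scalar mul_scalar_mx memvZ.
  by have := BL (rsubmx w); rewrite memv_cap => /andP[].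
Qed.

Lemma enorm_onb n j (B : 'M[R]_(j, n)) (w : 'rV_j) : B *m B^T = 1%:M ->
  enorm (w *m B) = enorm w.
Proof.
move=> BB; apply/eqP; rewrite -(@eqrXn2 _ 2) ?enorm_ge0// !enorm_sqr.
by rewrite dot_adjoint -mulmxA BB mulmx1.
Qed.

(** The first summand is the distance of v to the row space of B, the second
    one lives in that space. *)
Lemma pythagoras n j (B : 'M[R]_(j, n)) (v : 'rV_n) (w : 'rV_j) : B *m B^T = 1%:M ->
  enorm (v - w *m B) ^+ 2 =
  enorm (v - v *m B^T *m B) ^+ 2 + enorm (v *m B^T - w) ^+ 2.
Proof.
move=> BB; set p := v *m B^T.
rewrite -(enorm_onb (p - w) BB) mulmxBl.
have -> : v - w *m B = (v - p *m B) + (p *m B - w *m B) by rewrite addrA subrK.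
have o : dot (v - p *m B) ((p - w) *m B) = 0.
  rewrite dotC dot_adjoint mulmxBl -[p *m B *m _]mulmxA BB mulmx1 subrr.
  by rewrite dotC /dot big1// => i _; rewrite mxE mul0r.
rewrite -mulmxBl; move: o; move: (v - p *m B) ((p - w) *m B) => a b o.
by rewrite !enorm_sqr dotDl !dotDr (dotC b a) o addr0 add0r.
Qed.

Lemma enorm_coord_le n j (B : 'M[R]_(j, n)) (v : 'rV_n) : B *m B^T = 1%:M ->
  enorm (v *m B^T) <= enorm v.
Proof.
move=> BB; rewrite -ler_sqr ?nnegrE ?enorm_ge0//.
by have := pythagoras v 0 BB; rewrite mul0mx !subr0 => ->; rewrite lerDr sqr_ge0.
Qed.

Lemma nbhd_translate n (L : {vspace 'rV[R]_n}) (x z : 'rV[R]_n) r :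
  nbhd_of (translate L x) r z <-> exists2 l, l \in L & enorm (z - x - l) < r.
Proof.
split => [|[l lL zl]].
  move=> /ereal_inf_lt[_ [_ [l lL <-] <-]]; rewrite lte_fin => h.
  by exists l => //; rewrite -addrA -opprD [x + l]addrC.
apply: le_lt_trans (_ : ((enorm (z - x - l))%:E < _)%E); last by rewrite lte_fin.
apply: ereal_inf_lbound; exists (l + x); first by exists l.
by rewrite opprD addrA addrAC.
Qed.

(** The projection realises the distance to the row space of B, which contains
    L; so closeness to L passes to the residual of the projection. *)
Lemma nbhd_onb n j (L : {vspace 'rV[R]_n}) (B : 'M[R]_(j, n)) (x z : 'rV[R]_n) r :
  B *m B^T = 1%:M -> (forall v, v \in L -> v *m B^T *m B = v) ->
  nbhd_of (translate L x) r z -> enorm ((z - x) - (z - x) *m B^T *m B) < r.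
Proof.
move=> BB LB /nbhd_translate[l lL]; apply: le_lt_trans.
rewrite -ler_sqr ?nnegrE ?enorm_ge0// -[in leRHS](LB _ lL) (pythagoras _ (l *m B^T) BB).
by rewrite lerDl sqr_ge0.
Qed.

End Planes.

(** * Hausdorff measure and finite covers *)

Section Hausdorff.
Variable R : realType.
Implicit Types n m j : nat.

Definition diam_le n (F : set 'rV[R]_n) (d : R) :=
  forall x y, F x -> F y -> enorm (x - y) <= d.

Lemma ediamP n (F : set 'rV[R]_n) d : (ediam F <= d%:E)%E <-> diam_le F d.
Proof.
split => [Fd x y Fx Fy|Fd].
  rewrite -lee_fin; apply: le_trans Fd; apply: ereal_sup_ubound.
  by exists (x, y).
by apply: ge_ereal_sup => _ [[x y] [/= Fx Fy] <-]; rewrite lee_fin Fd.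
Qed.

Lemma diam_pow_ge0 n s (F : set 'rV[R]_n) : (0 <= diam_pow s F)%E.
Proof. by rewrite /diam_pow; case: ifP => // _; exact: poweR_ge0. Qed.

Lemma ediam_ge0 n (F : set 'rV[R]_n) : F !=set0 -> (0 <= ediam F)%E.
Proof.
move=> [x Fx]; apply: le_ereal_sup_tmp; exists 0%E => //.
by exists (x, x) => //=; rewrite subrr enorm0.
Qed.

Lemma diam_pow_le n s (F : set 'rV[R]_n) d : 0 <= s -> 0 <= d ->
  diam_le F d -> (diam_pow s F <= (d `^ s)%:E)%E.
Proof.
move=> s0 d0 /ediamP Fd; rewrite /diam_pow; case: ifPn => [_|/set0P/ediam_ge0 F0].
  by rewrite lee_fin powR_ge0.
rewrite -poweR_EFin; apply: gt0_ler_poweR => //.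
  by rewrite in_itv/= F0 leey.
by rewrite in_itv/= lee_fin d0 leey.
Qed.

Lemma hausdorff_pre_ge0 n s d (A : set 'rV[R]_n) : (0 <= hausdorff_pre s d A)%E.
Proof.
apply: le_ereal_inf_tmp => _ [F _ <-]; apply: nneseries_ge0 => k _ _.
exact: diam_pow_ge0.
Qed.

Lemma hausdorff_pre_le n s d (A B : set 'rV[R]_n) : A `<=` B ->
  (hausdorff_pre s d A <= hausdorff_pre s d B)%E.
Proof.
move=> AB; apply: ereal_inf_le_tmp => _ [F [BF Fd] <-]; exists F => //; split => //.
exact: subset_trans BF.
Qed.

Lemma hausdorff_le n s (A B : set 'rV[R]_n) : A `<=` B ->
  (hausdorff s A <= hausdorff s B)%E.
Proof.
move=> AB; apply: ge_ereal_sup => _ [d d0 <-].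
apply: (le_trans (hausdorff_pre_le s d AB)).
by apply: ereal_sup_ubound; exists d.
Qed.

Lemma hausdorff_pre_le_hausdorff n s d (A : set 'rV[R]_n) : 0 < d ->
  (hausdorff_pre s d A <= hausdorff s A)%E.
Proof. by move=> d0; apply: ereal_sup_ubound; exists d. Qed.

Lemma hausdorff_ge0 n s (A : set 'rV[R]_n) : (0 <= hausdorff s A)%E.
Proof.
by apply: le_trans (hausdorff_pre_le_hausdorff s A ltr01); exact: hausdorff_pre_ge0.
Qed.

Lemma hausdorff_eq0P n s (A : set 'rV[R]_n) :
  hausdorff s A = 0%E <-> forall d, 0 < d -> hausdorff_pre s d A = 0%E.
Proof.
split => [A0 d d0|A0]; apply/eqP; rewrite eq_le.
  by rewrite hausdorff_pre_ge0 andbT -A0 hausdorff_pre_le_hausdorff.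
rewrite hausdorff_ge0 andbT.
by apply: ge_ereal_sup => _ [d d0 <-]; rewrite A0.
Qed.

Lemma hausdorff_null_sub n s (A B : set 'rV[R]_n) : A `<=` B ->
  hausdorff s B = 0%E -> hausdorff s A = 0%E.
Proof.
by move=> AB B0; apply/eqP; rewrite eq_le hausdorff_ge0 andbT -B0; exact: hausdorff_le.
Qed.

(** On the discrete sigma-algebra every set is measurable, so the size-delta
    premeasure becomes an instance of the outer measure built from a set
    function; sets of diameter above delta are priced at infinity.  Countable
    subadditivity then comes for free. *)
Lemma hausdorff_pre_mu_ext n s d (A : set 'rV[R]_n) :
  hausdorff_pre s d A =
  mu_ext (fun F : set (g_sigma_algebraType [set: set 'rV[R]_n]) =>
    if (ediam F <= d%:E)%E then diam_pow s F else +oo%E) A.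
Proof.
apply/eqP; rewrite eq_le; apply/andP; split.
  apply: le_ereal_inf_tmp => /= _ [F [_ AF] <-].
  have [Fd|/existsNP[k /negP Fk]] := pselect (forall k, (ediam (F k) <= d%:E)%E).
    apply: ereal_inf_lbound; exists F => //.
    by apply: eq_eseriesr => k _; rewrite Fd.
  rewrite (@nneseries_pinfty _ _ xpredT k) ?leey ?(negbTE Fk)//.
  by move=> i _; case: ifP => _ //; exact: diam_pow_ge0.
apply: le_ereal_inf_tmp => /= _ [F [AF Fd] <-]; apply: ereal_inf_lbound; exists F.
  by split => // k; exact: sub_sigma_algebra.
by apply: eq_eseriesr => k _; rewrite Fd.
Qed.

Lemma hausdorff_pre_bigcup n s d (A : nat -> set 'rV[R]_n) :
  (hausdorff_pre s d (\bigcup_i A i) <= \sum_(i <oo) hausdorff_pre s d (A i))%E.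
Proof.
rewrite hausdorff_pre_mu_ext (eq_eseriesr (fun i _ => hausdorff_pre_mu_ext s d (A i))).
apply: mu_ext_sigma_subadditive => F; case: ifP => // _; exact: diam_pow_ge0.
Qed.

Lemma hausdorff_null_bigcup n s (A : nat -> set 'rV[R]_n) :
  (forall i, hausdorff s (A i) = 0%E) -> hausdorff s (\bigcup_i A i) = 0%E.
Proof.
move=> A0; apply/hausdorff_eq0P => d d0; apply/eqP; rewrite eq_le hausdorff_pre_ge0 andbT.
apply: le_trans (hausdorff_pre_bigcup _ _ _) _.
by rewrite eseries0// => i _ _; exact: (hausdorff_eq0P _ _).1.
Qed.

(** Finite covers suffice for all upper bounds below; the index type 'I_N makes
    them easy to iterate and to combine. *)
Definition covered n (E : set 'rV[R]_n) (N : nat) (d : R) :=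
  exists F : 'I_N -> set 'rV[R]_n,
    (forall x, E x -> exists i, F i x) /\ forall i, diam_le (F i) d.

Lemma covered_fin n (E : set 'rV[R]_n) (T : finType) (F : T -> set 'rV[R]_n) d :
  (forall x, E x -> exists i, F i x) -> (forall i, diam_le (F i) d) ->
  covered E #|T| d.
Proof.
move=> EF Fd; exists (F \o enum_val); split => [x /EF[t Ftx]|i]; last exact: Fd.
by exists (enum_rank t); rewrite /= enum_rankK.
Qed.

Lemma hausdorff_pre_covered n s d delta (E : set 'rV[R]_n) N : 0 <= s ->
  0 <= d <= delta -> covered E N d ->
  (hausdorff_pre s delta E <= (N%:R * d `^ s)%:E)%E.
Proof.
move=> s0 /andP[d0 dd] [F [EF Fd]].
pose G k : set 'rV[R]_n := if insub k is Some i then F i else set0.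
have Gd k : diam_le (G k) d by rewrite /G; case: insubP => [i _ _|_] //=.
apply: (@le_trans _ _ (\sum_(0 <= k <oo) diam_pow s (G k))%E).
  apply: ereal_inf_lbound; exists G => //; split => [x /EF[i Fix]|k].
    by exists (nat_of_ord i) => //; rewrite /G valK.
  by apply/ediamP => x y Gx Gy; apply: le_trans dd; exact: Gd Gx Gy.
rewrite (@nneseries_split _ _ 0 N); last by move=> *; exact: diam_pow_ge0.
rewrite [X in (_ + X)%E]eseries0 => [|k kN _]; last first.
  by rewrite /G insubF ?ltnNge ?kN//; rewrite /diam_pow eqxx.
rewrite adde0 add0n big_mkord.
apply: (@le_trans _ _ (\sum_(i < N) (d `^ s)%:E)%E).
  by apply: lee_sum => i _; exact: diam_pow_le.
by rewrite sumEFin sumr_const card_ord mulr_natl.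
Qed.

(** The mesh and the s-sum are both controlled by the same e. *)
Lemma hausdorff_null_covered n s (E : set 'rV[R]_n) : 0 <= s ->
  (forall e, 0 < e -> exists N d, [/\ covered E N d, 0 <= d <= e & N%:R * d `^ s <= e]) ->
  hausdorff s E = 0%E.
Proof.
move=> s0 H; apply/hausdorff_eq0P => d d0; apply/eqP; rewrite eq_le hausdorff_pre_ge0 andbT.
apply/lee_addgt0Pr => e e0; rewrite add0e.
have [|N [t [Et /andP[t0 td] Nt]]] := H (Num.min d e); first by rewrite lt_min d0.
apply: (@le_trans _ _ (N%:R * t `^ s)%:E).
  by apply: hausdorff_pre_covered => //; rewrite t0 (le_trans td)// ge_min lexx.
by rewrite lee_fin (le_trans Nt)// ge_min lexx orbT.
Qed.

(** Finite upper Minkowski content in dimension j, up to constants. *)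
Definition minkowski_finite n j (E : set 'rV[R]_n) := exists2 K : R, 0 < K &
  forall M : nat, (0 < M)%N ->
    exists2 N : nat, N%:R <= K * M%:R ^+ j & covered E N (K / M%:R).

(** At mesh K / M the j-sum is at most K M^j (K / M)^j = K^(j+1), uniformly in M. *)
Lemma minkowski_hausdorff_lty n j (E : set 'rV[R]_n) : minkowski_finite j E ->
  (hausdorff j%:R E < +oo)%E.
Proof.
move=> [K K0 EK]; apply: (@le_lt_trans _ _ (K * K ^+ j)%:E); last exact: ltry.
apply: ge_ereal_sup => _ [d d0 <-].
pose M := (Num.truncn (K / d)).+1.
have M0 : 0 < M%:R :> R by rewrite ltr0n.
have Kd : K / M%:R <= d.
  by rewrite ler_pdivrMr// mulrC -ler_pdivrMr// ltW// truncnS_gt.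
have [//|N NK EN] := EK M.
apply: le_trans (hausdorff_pre_covered _ _ EN) _ => //.
  by rewrite Kd divr_ge0// ltW.
rewrite lee_fin powR_mulrn ?divr_ge0 ?(ltW K0)//.
apply: le_trans (ler_wpM2r _ NK) _; first by rewrite exprn_ge0// divr_ge0// ltW.
by rewrite expr_div_n -mulrA [_ * (_ / _)]mulrCA divff ?mulr1// expf_neq0 ?gt_eqF.
Qed.

Lemma powR_large (a c : R) : 0 < a -> 0 <= c -> exists y, forall x, y <= x -> 0 <= x ->
  c <= x `^ a.
Proof.
move=> a0 c0; exists (c `^ a^-1) => x yx x0.
apply: le_trans (_ : (c `^ a^-1) `^ a <= _); first by rewrite -powRrM mulVf ?gt_eqF// powRr1.
by apply: ge0_ler_powR; rewrite ?(ltW a0)// ?nnegrE ?powR_ge0.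
Qed.

(** The left-hand side is K^s M^(j-s), and j - s is negative. *)
Lemma exponent_gap (j : nat) (s K e : R) : j%:R < s -> 0 < K -> 0 < e ->
  exists y : R, forall M : nat, (0 < M)%N -> y <= M%:R ->
    M%:R ^+ j * (K / M%:R) `^ s <= e.
Proof.
move=> js K0 e0; have sj : 0 < s - j%:R by rewrite subr_gt0.
have [y yP] := @powR_large (s - j%:R) (K `^ s / e) sj (divr_ge0 (powR_ge0 _ _) (ltW e0)).
exists y => M M0 yM; have M1 : 0 < M%:R :> R by rewrite ltr0n.
rewrite powRM ?invr_ge0 ?(ltW K0)// -powR_inv1 ?(ltW M1)// -powRrM mulN1r.
rewrite -powR_mulrn ?(ltW M1)// mulrCA -powRD; last by apply/implyP => _; rewrite gt_eqF.
have Ms : 0 < M%:R `^ (s - j%:R) by rewrite powR_gt0.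
rewrite -opprB powRN ler_pdivrMr// [e * _]mulrC -ler_pdivrMr//.
by apply: yP => //; exact: ltW.
Qed.

Lemma minkowski_hausdorff_eq0 n j (E : set 'rV[R]_n) s : minkowski_finite j E ->
  j%:R < s -> hausdorff s E = 0%E.
Proof.
move=> [K K0 EK] js; have s0 : 0 < s by apply: le_lt_trans js; rewrite ler0n.
apply: hausdorff_null_covered => [|e e0]; first exact: ltW.
have [y yP] := exponent_gap js K0 (divr_gt0 e0 K0).
pose M := (Num.truncn (Num.max (K / e) y)).+1.
have M0 : 0 < M%:R :> R by rewrite ltr0n.
have /andP[eM yM] : (K / e <= M%:R) && (y <= M%:R) by rewrite -ge_max ltW// truncnS_gt.
have [//|N NK EN] := EK M; exists N, (K / M%:R); split => //.
  by rewrite divr_ge0 ?(ltW K0)//= ler_pdivrMr// mulrC -ler_pdivrMr.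
apply: le_trans (ler_wpM2r (powR_ge0 _ _) NK) _.
by rewrite -mulrA mulrC -ler_pdivlMr// yP.
Qed.

(** Infimum over the exponents j + e. *)
Lemma dim_leP n j (A : set 'rV[R]_n) :
  (forall s, j%:R < s -> hausdorff s A = 0%E) -> dim_le R n j A.
Proof.
move=> A0; apply/lee_addgt0Pr => e e0; rewrite -EFinD.
apply: ereal_inf_lbound; exists (j%:R + e) => //=; split.
  by rewrite addr_ge0// ltW.
by apply: A0; rewrite ltrDl.
Qed.

End Hausdorff.

(** * Covers of sets that project well to a space of dimension j *)

Section Covers.
Variable R : realType.
Implicit Types n m j : nat.

(** Cell labels for the cube of side 2 S cut into M^j subcubes: equal labels
    force each coordinate difference below 2 S / M. *)
Lemma grid j (M : nat) (S : R) : (0 < M)%N -> 0 < S ->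
  exists c : 'rV[R]_j -> {ffun 'I_j -> 'I_M},
    forall w w' : 'rV[R]_j, (forall i, `|w 0 i| <= S) -> (forall i, `|w' 0 i| <= S) ->
      c w = c w' -> enorm (w - w') <= j%:R * (2 * S / M%:R).
Proof.
case: M => // M _ S0; set N : R := M.+1%:R; have N0 : 0 < N by rewrite ltr0n.
pose u (x : R) := (x + S) / (2 * S) * N.
have uP x : `|x| <= S -> 0 <= u x <= N.
  rewrite ler_norml => /andP[x1 x2]; apply/andP; split.
    by rewrite mulr_ge0 ?(ltW N0)// divr_ge0; lra.
  by rewrite ler_piMl ?(ltW N0)// ler_pdivrMr; lra.
pose k (x : R) : 'I_M.+1 := inord (minn (Num.truncn (u x)) M).
have kP x : `|x| <= S -> (k x)%:R <= u x <= (k x)%:R + 1.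
  move=> /uP /andP[u0 uN]; rewrite /k inordK ?ltnS ?geq_minr//.
  have /andP[t1 t2] := truncn_itv u0.
  have [h|h] := leqP (Num.truncn (u x)) M; first by move: t2; rewrite -natr1; lra.
  by rewrite natr1 uN andbT (le_trans _ t1)// ler_nat ltnW.
have S2 : 0 <= 2 * S by lra.
exists (fun w => [ffun i => k (w 0 i)]) => w w' wS w'S /ffunP ww'.
apply: enorm_le_coords => i; rewrite !mxE.
have /andP[a1 a2] := kP _ (wS i); have /andP[b1 b2] := kP _ (w'S i).
have := ww' i; rewrite !ffunE => kk; rewrite kk in a1 a2.
have -> : w 0 i - w' 0 i = (u (w 0 i) - u (w' 0 i)) * (2 * S / N).
  by rewrite /u; field; rewrite !gt_eqF.
rewrite normrM [X in _ * X]ger0_norm ?divr_ge0 ?(ltW N0)//.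
rewrite ler_piMl ?divr_ge0 ?(ltW N0)//.
by rewrite ler_norml; lra.
Qed.

(** Pull the grid back along phi: points of E with the same label have close
    images, hence are close. *)
Lemma covered_param n j (E : set 'rV[R]_n) (phi : 'rV[R]_n -> 'rV[R]_j) (M : nat) S d :
  (0 < M)%N -> 0 < S -> (forall z i, E z -> `|phi z 0 i| <= S) ->
  (forall z z', E z -> E z' -> enorm (phi z - phi z') <= j%:R * (2 * S / M%:R) ->
     enorm (z - z') <= d) ->
  covered E (M ^ j) d.
Proof.
move=> M0 S0 ES Ed; have [c cP] := grid j M0 S0.
have -> : (M ^ j)%N = #|{ffun 'I_j -> 'I_M}| by rewrite card_ffun !card_ord.
apply: (covered_fin (F := fun t => [set z | E z /\ c (phi z) = t])).
  by move=> x Ex; exists (c (phi x)).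
move=> t x y [Ex cx] [Ey cy]; apply: Ed => //; apply: cP.
- by move=> i; exact: ES.
- by move=> i; exact: ES.
- by rewrite cx.
Qed.

(** Points with the same grid label in the plane differ by at most a cell
    diameter along the plane and by 2 e across it. *)
Lemma flat_covered n j (B : 'M[R]_(j, n)) (F : set 'rV[R]_n) x (M : nat) t e :
  (0 < M)%N -> 0 < t -> B *m B^T = 1%:M -> (forall z, F z -> enorm (z - x) <= t) ->
  (forall z, F z -> enorm ((z - x) - (z - x) *m B^T *m B) <= e) ->
  covered F (M ^ j) (j%:R * (2 * t / M%:R) + 2 * e).
Proof.
move=> M0 t0 BB Ft Fe.
apply: (covered_param (phi := fun z => (z - x) *m B^T) (S := t)) => //.
  move=> z i Fz; apply: le_trans (enorm_coord _ _) _.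
  by apply: le_trans (enorm_coord_le _ BB) _; exact: Ft.
move=> z z' Fz Fz'; set P := (z - x) *m B^T; set P' := (z' - x) *m B^T => PP.
have -> : z - z' = ((z - x) - P *m B) - ((z' - x) - P' *m B) + (P - P') *m B.
  rewrite mulmxBl; move: (P *m B) (P' *m B) => a b.
  by apply/rowP => i; rewrite !mxE; ring.
apply: le_trans (enormD _ _) _; rewrite (enorm_onb _ BB).
have := enormD (z - x - P *m B) (- (z' - x - P' *m B)); rewrite enormN.
have := Fe z Fz; have := Fe z' Fz'; rewrite -/P -/P' => p1 p2 p3.
by move: PP p1 p2 p3; lra.
Qed.

Lemma covered_weak n (E E' : set 'rV[R]_n) N d d' : covered E N d -> E' `<=` E ->
  d <= d' -> covered E' N d'.
Proof.
move=> [F [EF Fd]] sE dd; exists F; split => [x /sE/EF//|i x y Fx Fy].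
exact: le_trans (Fd i _ _ Fx Fy) dd.
Qed.

(** Boundedness for the Euclidean norm. *)
Definition ebounded n (E : set 'rV[R]_n) := exists S, forall z, E z -> enorm z <= S.

Lemma ebounded_sub n (E F : set 'rV[R]_n) : E `<=` F -> ebounded F -> ebounded E.
Proof. by move=> EF [S FS]; exists S => z /EF/FS. Qed.

Lemma ebounded_diam_le n (E : set 'rV[R]_n) d : diam_le E d -> ebounded E.
Proof.
move=> Ed; have [[x Ex]|E0] := pselect (E !=set0); last first.
  by exists 0 => z Ez; case: E0; exists z.
exists (enorm x + d) => z Ez.
by have := Ed _ _ Ez Ex; have := enorm_sub z x; lra.
Qed.

Lemma ebounded_eball n (E : set 'rV[R]_n) x r : E `<=` eball x r -> ebounded E.
Proof.
move=> Er; apply: (@ebounded_diam_le _ _ (r + r)) => y z /Er yr /Er zr.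
move: yr zr; rewrite /eball/= => yr zr.
by have := enorm_triangle x y z; rewrite (enormB x z); lra.
Qed.

(** Linear projections that are injective on E with Lipschitz inverse: E is then
    a Lipschitz graph over a subset of R^j. *)
Definition colipschitz n j (E : set 'rV[R]_n) := exists Q : 'M[R]_(n, j),
  exists2 c : R, 0 < c &
    forall x y, E x -> E y -> c * enorm (x - y) <= enorm ((x - y) *m Q).

Lemma colipschitz_minkowski n j (E : set 'rV[R]_n) : ebounded E -> colipschitz j E -> minkowski_finite j E.
Proof.
move=> [S ES] [Q [c c0 Qc]].
have [C C0 CQ] := enorm_mulmx Q.
pose T := C * (`|S| + 1).
have T0 : 0 < T by rewrite mulr_gt0// ltr_wpDl.
have P0 : 0 <= j%:R * (2 * T) / c by apply: divr_ge0; [apply: mulr_ge0; [exact: ler0n|lra] |exact: ltW].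
pose K := j%:R * (2 * T) / c + 1.
have K0 : 0 < K by rewrite ltr_wpDl.
exists K => // M M0; exists (M ^ j)%N.
  by rewrite natrX ler_peMl ?exprn_ge0// /K lerDr.
apply: (covered_param (phi := fun z => z *m Q) (S := T)) => //.
  move=> z i Ez; apply: le_trans (enorm_coord _ _) _; apply: le_trans (CQ _) _.
  by rewrite ler_pM2l//; have := ES _ Ez; have := ler_norm S; lra.
move=> z z' Ez Ez'; rewrite -mulmxBl => h.
have M0' : 0 < M%:R :> R by rewrite ltr0n.
rewrite -(ler_pM2l c0); apply: le_trans (Qc _ _ Ez Ez') _; apply: le_trans h _.
have -> : c * (K / M%:R) = j%:R * (2 * T / M%:R) + c / M%:R by rewrite /K; field; rewrite !gt_eqF.
by rewrite lerDl divr_ge0// ltW.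
Qed.

Lemma ebounded_covered n (E : set 'rV[R]_n) d : ebounded E -> 0 < d ->
  exists N, covered E N d.
Proof.
move=> Eb d0; have [|K K0 EK] := @colipschitz_minkowski n n E Eb.
  by exists 1%:M, 1 => // x y _ _; rewrite mulmx1 mul1r.
have [//|N _ EN] := EK (Num.truncn (K / d)).+1.
exists N; apply: (covered_weak EN) => //.
by rewrite ler_pdivrMr// mulrC -ler_pdivrMr// ltW// truncnS_gt.
Qed.

(** Label a point of the image by the grid cell of a chosen preimage. *)
Lemma lipschitz_minkowski n j (f : 'rV[R]_j -> 'rV[R]_n) S : elipschitz f ->
  minkowski_finite j (f @` [set w | enorm w <= S]).
Proof.
move=> [C0 fC0]; pose C := `|C0| + 1; have C_gt0 : 0 < C by rewrite ltr_wpDl.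
have fC x y : enorm (f x - f y) <= C * enorm (x - y).
  apply: le_trans (fC0 x y) _; rewrite ler_wpM2r ?enorm_ge0//.
  by rewrite /C; have := ler_norm C0; lra.
pose T := `|S| + 1; have T0 : 0 < T by rewrite ltr_wpDl.
have P0 : 0 <= C * (j%:R * (2 * T)) by apply: mulr_ge0; [exact: ltW|apply: mulr_ge0; [exact: ler0n|lra]].
pose K := C * (j%:R * (2 * T)) + 1.
have K0 : 0 < K by rewrite ltr_wpDl.
exists K => // M M0; exists (M ^ j)%N.
  by rewrite natrX ler_peMl ?exprn_ge0// /K lerDr.
pose g z := xget 0 [set w | enorm w <= S /\ f w = z].
have gP z : (f @` [set w | enorm w <= S]) z -> enorm (g z) <= S /\ f (g z) = z.
  by move=> [w wS wz]; have := @xgetI _ 0 [set w | enorm w <= S /\ f w = z] w (conj wS wz).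
apply: (covered_param (phi := g) (S := T)) => // [z i /gP[gz _]|z z' /gP[_ gz] /gP[_ gz'] h].
  by apply: le_trans (enorm_coord _ _) _; rewrite /T; have := ler_norm S; lra.
have M0' : 0 < M%:R :> R by rewrite ltr0n.
rewrite -gz -gz'; apply: le_trans (fC _ _) _.
apply: le_trans (_ : C * (j%:R * (2 * T / M%:R)) <= _); first by rewrite ler_pM2l.
have -> : K / M%:R = C * (j%:R * (2 * T / M%:R)) + M%:R^-1 by rewrite /K; field; rewrite gt_eqF.
by rewrite lerDl invr_ge0.
Qed.

(** Covers of the pieces are joined over the disjoint sum of their index types. *)
Lemma minkowski_fin n j (A : set 'rV[R]_n) (T : finType) (E : T -> set 'rV[R]_n) :
  (forall x, A x -> exists t, E t x) -> (forall t, minkowski_finite j (E t)) -> minkowski_finite j A.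
Proof.
move=> AE Em; have /choice[K KP] : forall t, exists K : R, 0 < K /\
    forall M : nat, (0 < M)%N ->
    exists2 N : nat, N%:R <= K * M%:R ^+ j & covered (E t) N (K / M%:R).
  by move=> t; have [K K0 KP] := Em t; exists K.
have K0 t : 0 <= K t by rewrite ltW; have [] := KP t.
exists (1 + \sum_t K t) => [|M M0]; first by rewrite ltr_pwDl// sumr_ge0.
have /choice[N NP] : forall t, exists N : nat, N%:R <= K t * M%:R ^+ j /\
    covered (E t) N (K t / M%:R).
  by move=> t; have [_ /(_ M M0)[N ? ?]] := KP t; exists N.
exists (\sum_t N t)%N.
  rewrite natr_sum mulrDl mulr_suml ler_wpDl ?exprn_ge0 ?mul1r//.
  by apply: ler_sum => t _; have [] := NP t.
have F0 t : {F : 'I_(N t) -> set 'rV[R]_n |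
    (forall x, E t x -> exists i, F i x) /\ forall i, diam_le (F i) (K t / M%:R)}.
  by apply: cid; have [] := NP t.
have -> : (\sum_t N t)%N = #|{: {t : T & 'I_(N t)}}|.
  by rewrite card_tagged sumnE big_map big_enum/=; apply: eq_bigr => t _; rewrite card_ord.
apply: (covered_fin (F := fun p : {t : T & 'I_(N t)} => sval (F0 (tag p)) (tagged p))).
  move=> x /AE[t /(proj1 (svalP (F0 t)))[i Fi]].
  by exists (Tagged (fun t => 'I_(N t)) i).
move=> [t i] x y /= Fx Fy; apply: le_trans ((proj2 (svalP (F0 t))) _ _ _ Fx Fy) _.
rewrite ler_pM2r ?invr_gt0 ?ltr0n// (bigD1 t)//=.
by rewrite addrCA lerDl addr_ge0// sumr_ge0.
Qed.

End Covers.

(** * Countable pieces, Lipschitz extension, cones *)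

Section Pieces.
Variable R : realType.
Implicit Types n m j : nat.

Lemma rat_matrix_dense m n (Q : 'M[R]_(m, n)) e : 0 < e ->
  exists q : 'M[rat]_(m, n), forall i k, `|(Q - map_mx ratr q) i k| <= e.
Proof.
move=> e0; have /choice[q qP] : forall p : 'I_m * 'I_n, exists q : rat,
    `|Q p.1 p.2 - ratr q| <= e.
  move=> p; have [|q] := @rat_in_itvoo R (Q p.1 p.2 - e) (Q p.1 p.2 + e).
    by rewrite ltrBlDr -addrA ltrDl addr_gt0.
  by rewrite in_itv/= => /andP[q1 q2]; exists q; rewrite ler_norml; lra.
by exists (\matrix_(i, k) q (i, k)) => i k; rewrite !mxE; exact: (qP (i, k)).
Qed.

(** A family over a countable type as a sequence; the codes of no element
    give the empty set. *)
Lemma countable_family (T : countType) n (E : T -> set 'rV[R]_n) :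
  exists F : nat -> set 'rV[R]_n, (forall t, exists i, F i = E t) /\
    forall i, F i = set0 \/ exists t, F i = E t.
Proof.
exists (fun i => if unpickle i is Some t then E t else set0); split => [t|i].
  by exists (pickle t); rewrite pickleK.
by case: unpickle => [t|]; [right; exists t|left].
Qed.

(** Balls of radius 1 / (m + 1) around rational points.  This replaces the
    Lindeloef property: a local hypothesis with a radius at each point becomes
    a countable decomposition. *)
Lemma countable_base n : exists U : nat -> set 'rV[R]_n,
  (forall k, ebounded (U k)) /\ forall x r, 0 < r ->
    exists k, U k x /\ forall y, U k y -> enorm (y - x) < r.
Proof.
pose W (p : 'rV[rat]_n * nat) : set 'rV[R]_n := eball (map_mx ratr p.1) p.2.+1%:R^-1.
have [U [WU UW]] := countable_family W.
exists U; split => [k|x r r0].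
  have [->|[t ->]] := UW k; first by exists 0.
  exact: ebounded_eball (@subset_refl _ _).
pose m := Num.truncn (2 / r); have m0 : 0 < m.+1%:R :> R by rewrite ltr0n.
have mr : 2 * m.+1%:R^-1 < r.
  by rewrite ltr_pdivrMr// mulrC -ltr_pdivrMr// truncnS_gt.
have [|q qP] := @rat_matrix_dense 1 n x (m.+1%:R^-1 / n.+1%:R).
  by rewrite divr_gt0 ?invr_gt0// ltr0n.
have [k Uk] := WU (q, m); exists k; rewrite Uk /W /eball/=.
have xq : enorm (x - map_mx ratr q) < m.+1%:R^-1.
  apply: le_lt_trans (enorm_le_coords (qP 0)) _.
  rewrite mulrCA gtr_pMr ?invr_gt0// ltr_pdivrMr ?ltr0n// mul1r ltr_nat//.
split => // y yq; have := enorm_triangle (map_mx ratr q) y x.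
rewrite (enormB (map_mx ratr q) x); move: mr xq yq; move: (m.+1%:R^-1) => i; lra.
Qed.

(** The infimal convolution x |-> inf_y (f y + C |x - y|) over E. *)
Lemma mcshane n (E : set 'rV[R]_n) (f : 'rV[R]_n -> R) C :
  (forall x y, E x -> E y -> `|f x - f y| <= C * enorm (x - y)) -> 0 <= C ->
  exists2 g : 'rV[R]_n -> R, (forall x, E x -> g x = f x) &
    forall x y, `|g x - g y| <= C * enorm (x - y).
Proof.
move=> fC C0; have [[e Ee]|E0] := pselect (E !=set0); last first.
  exists (fun=> 0) => [x Ex|x y]; first by case: E0; exists x.
  by rewrite subrr normr0 mulr_ge0 ?enorm_ge0.
pose S x := [set f y + C * enorm (x - y) | y in E].
have lbS x : lbound (S x) (f e - C * enorm (x - e)).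
  move=> _ [y Ey <-]; have := fC _ _ Ee Ey; have := enorm_triangle x e y.
  rewrite (enormB e x) => t; have := ler_wpM2l C0 t; rewrite mulrDr ler_norml.
  by lra.
have Sx0 x : S x !=set0 by exists (f e + C * enorm (x - e)), e.
have hS x : has_inf (S x) by split => //; exists (f e - C * enorm (x - e)).
pose g x := inf (S x).
have gle x y : E y -> g x <= f y + C * enorm (x - y).
  by move=> Ey; apply: ge_inf; [have [] := hS x|exists y].
have leg x c : (forall y, E y -> c <= f y + C * enorm (x - y)) -> c <= g x.
  by move=> H; apply: lb_le_inf => // _ [y Ey <-]; exact: H.
exists g => [x Ex|x y].
  apply/eqP; rewrite eq_le; apply/andP; split.
    by have := gle x x Ex; rewrite subrr enorm0 mulr0 addr0.
  by apply: leg => y Ey; have := fC _ _ Ex Ey; rewrite ler_norml; lra.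
have half u v : g u - g v <= C * enorm (u - v).
  rewrite lerBlDr addrC -lerBlDr; apply: leg => z Ez; have := gle u z Ez.
  by have := ler_wpM2l C0 (enorm_triangle v u z); rewrite mulrDr; lra.
by rewrite ler_norml lerNl opprB half andbT enormB half.
Qed.

Lemma colipschitz_lipschitz_image n j (E : set 'rV[R]_n) : colipschitz j E ->
  exists2 f : 'rV[R]_j -> 'rV[R]_n, elipschitz f & E `<=` range f.
Proof.
move=> [Q [c c0 Qc]].
pose D : set 'rV[R]_j := [set z *m Q | z in E].
pose h w := xget 0 [set z | E z /\ z *m Q = w].
have hP z : E z -> h (z *m Q) = z.
  move=> Ez; have [Eh hz] := @xgetI _ 0 [set x | E x /\ x *m Q = z *m Q] z (conj Ez erefl).
  rewrite -/(h (z *m Q)) in Eh hz.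
  apply/eqP; rewrite -subr_eq0; apply/eqP/enorm0_eq/eqP.
  have := Qc _ _ Eh Ez; rewrite mulmxBl hz subrr enorm0 pmulr_rle0//.
  by rewrite eq_le enorm_ge0 andbT.
have ci : 0 <= c^-1 by rewrite invr_ge0 ltW.
have /choice[g gP] : forall i : 'I_n, exists g : 'rV[R]_j -> R,
    (forall w, D w -> g w = h w 0 i) /\ forall x y, `|g x - g y| <= c^-1 * enorm (x - y).
  move=> i; have [|g g1 g2] := @mcshane j D (fun w => h w 0 i) c^-1 _ ci; last by exists g.
  move=> _ _ [z Ez <-] [z' Ez' <-]; rewrite !hP//.
  rewrite ler_pdivlMl// -mulmxBl; apply: le_trans (Qc _ _ Ez Ez').
  by rewrite ler_pM2l//; have := enorm_coord (z - z') i; rewrite !mxE.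
exists (fun w => \row_i g i w).
  exists (n%:R * c^-1) => x y; rewrite -mulrA; apply: enorm_le_coords => i.
  by rewrite !mxE; exact: (gP i).2.
move=> z Ez; exists (z *m Q) => //; apply/rowP => i; rewrite mxE (gP i).1 ?hP//.
by exists z.
Qed.

(** Apply flatness at a radius slightly larger than |z - x|: the component of
    v = z - x across L is at most gamma (1 + b) |v| with b = (1 - gamma) / 2.  By
    Pythagoras the component along L has square at least
    (1 - gamma^2 (1 + b)^2) |v|^2 >= b^2 |v|^2, because gamma (1 + b) <= 1 - b. *)
Lemma flat_cone n j (A : set 'rV[R]_n) (L : {vspace 'rV[R]_n}) (B : 'M[R]_(j, n))
    gamma r (x : 'rV[R]_n) :
  B *m B^T = 1%:M -> (forall v, v \in L -> v *m B^T *m B = v) ->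
  0 < gamma < 1 ->
  (forall rho, 0 < rho <= r ->
     eball x rho `&` A `<=` nbhd_of (translate L x) (gamma * rho)) ->
  forall z, A z -> enorm (z - x) <= r / 2 ->
    (1 - gamma) / 2 * enorm (z - x) <= enorm ((z - x) *m B^T).
Proof.
move=> BB LB /andP[g0 g1] flat z Az zr.
have [->|zx] := eqVneq (z - x) 0; first by rewrite mul0mx !enorm0 mulr0.
set v := z - x in zr zx *; have v0 := enorm_gt0 zx.
set t := enorm v in zr v0 *.
(* a radius slightly larger than |v|, so that z lies in the open ball *)
pose rho := t * (1 + (1 - gamma) / 2).
have rho0 : 0 < rho by rewrite mulr_gt0//; lra.
have trho : t < rho by rewrite /rho ltr_pMr//; lra.
have rr : rho <= r.
  have : t * (1 - gamma) <= t * 1 by rewrite ler_pM2l//; lra.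
  by rewrite /rho; lra.
have /(nbhd_onb BB LB) := flat rho (introT andP (conj rho0 rr)) z (conj trho Az).
rewrite -/v => vd.
have py := pythagoras v 0 BB; rewrite mul0mx !subr0 in py.
set d := enorm (v - _) in vd py; set p := enorm (_ *m B^T) in py *.
have d0 : 0 <= d by exact: enorm_ge0.
have p0 : 0 <= p by exact: enorm_ge0.
rewrite -ler_sqr ?nnegrE ?mulr_ge0 ?enorm_ge0//; last by lra.
have dt : d ^+ 2 <= (gamma * rho) ^+ 2 by rewrite ler_sqr ?nnegrE// ?ltW// mulr_gt0.
rewrite -/t in py *.
have -> : p ^+ 2 = t ^+ 2 - d ^+ 2 by rewrite py addrAC subrr add0r.
apply: le_trans (_ : t ^+ 2 - (gamma * rho) ^+ 2 <= _); last by rewrite lerB.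
set b := (1 - gamma) / 2; have b0 : 0 < b < 1 by rewrite /b; lra.
have -> : gamma * rho = gamma * (1 + b) * t by rewrite /rho mulrCA mulrC.
have a0 : 0 <= gamma * (1 + b) by rewrite mulr_ge0//; lra.
have ab : gamma * (1 + b) <= 1 - b by rewrite /b; nra.
have ab2 : 0 <= 1 - (gamma * (1 + b)) ^+ 2 - b ^+ 2 by nra.
rewrite -subr_ge0; have -> : t ^+ 2 - (gamma * (1 + b) * t) ^+ 2 - (b * t) ^+ 2 =
  t ^+ 2 * (1 - (gamma * (1 + b)) ^+ 2 - b ^+ 2) by ring.
by rewrite mulr_ge0 ?sqr_ge0.
Qed.

End Pieces.

(** * Positive answers: measure and rectifiability *)

Section YesAnswers.
Variable R : realType.
Implicit Types n m j : nat.

Lemma colipschitz_set0 n j : colipschitz j (set0 : set 'rV[R]_n).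
Proof. by exists 0, 1. Qed.

Lemma hausdorff_set0 n s : 0 <= s -> hausdorff s (set0 : set 'rV[R]_n) = 0%E.
Proof.
move=> s0; apply: hausdorff_null_covered => // e e0; exists 0%N, 0; split.
- by exists (fun=> set0); split => [x []|i x y []].
- by rewrite lexx ltW.
- by rewrite mul0r ltW.
Qed.

Lemma minkowski_sub n j (E F : set 'rV[R]_n) : E `<=` F -> minkowski_finite j F ->
  minkowski_finite j E.
Proof.
move=> EF [K K0 H]; exists K => // M /H[N NK cov]; exists N => //.
exact: covered_weak cov EF (lexx _).
Qed.

Lemma minkowski_strongly n j (A : set 'rV[R]_n) : minkowski_finite j A ->
  strongly_locally_finite R n j A.
Proof.
move=> Am K _; apply: minkowski_hausdorff_lty; apply: minkowski_sub Am.
exact: subIsetr.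
Qed.

Lemma minkowski_weakly n j (A : set 'rV[R]_n) : minkowski_finite j A ->
  weakly_locally_finite R n j A.
Proof.
move=> Am y Ay; exists 1 => //; apply: minkowski_hausdorff_lty; apply: minkowski_sub Am.
exact: subIsetr.
Qed.

Lemma minkowski_dim n j (A : set 'rV[R]_n) : minkowski_finite j A -> dim_le R n j A.
Proof. by move=> Am; apply: dim_leP => s /minkowski_hausdorff_eq0; exact. Qed.

(** Each piece is a null set for every exponent above j, and null sets are
    stable under countable unions, even if no local measure is finite. *)
Lemma pieces_dim n j (A : set 'rV[R]_n) (E : nat -> set 'rV[R]_n) :
  A `<=` \bigcup_i E i -> (forall i, minkowski_finite j (E i)) -> dim_le R n j A.
Proof.
move=> AE Em; apply: dim_leP => s js; apply: hausdorff_null_sub AE _.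
by apply: hausdorff_null_bigcup => i; exact: minkowski_hausdorff_eq0 (Em i) js.
Qed.

Lemma pieces_rectifiable n j (A : set 'rV[R]_n) (E : nat -> set 'rV[R]_n) :
  A `<=` \bigcup_i E i -> (forall i, colipschitz j (E i)) -> rectifiable R n j A.
Proof.
move=> AE Ec; have /choice[f fP] : forall i, exists f : 'rV[R]_j -> 'rV[R]_n,
    elipschitz f /\ E i `<=` range f.
  by move=> i; have [f ? ?] := colipschitz_lipschitz_image (Ec i); exists f.
exists set0, f; split => [||x /AE[i _ Eix]].
- by rewrite hausdorff_set0// ler0n.
- by move=> i; have [] := fP i.
- by right; exists i => //; exact: (fP i).2.
Qed.

(** A piece collects the points y of A in a basic ball U for which one rational
    matrix q is co-Lipschitz from y to every other point of A in U.  Every y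
    belongs to such a piece: take q near the coordinate map of L_y, so close
    that the error costs half of the constant in [flat_cone]. *)
Lemma sj_pieces gamma n j (A : set 'rV[R]_n) : 0 < gamma < 1 -> sj gamma n j A ->
  exists E : nat -> set 'rV[R]_n, A `<=` \bigcup_i E i /\
    forall i, ebounded (E i) /\ colipschitz j (E i).
Proof.
move=> g01 sA; have [U [Ub Ubase]] := countable_base R n.
have /andP[g0 g1] := g01.
pose c := (1 - gamma) / 4; have c0 : 0 < c by rewrite /c; lra.
pose E (p : 'M[rat]_(n, j) * nat) := [set y | [/\ A y, U p.2 y &
  forall z, A z -> U p.2 z -> c * enorm (z - y) <= enorm ((z - y) *m map_mx ratr p.1)]].
have [F [EF FE]] := countable_family E.
exists F; split => [y Ay|i]; last first.
  have [->|[t ->]] := FE i; first by split; [exists 0|exact: colipschitz_set0].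
  split; first by apply: ebounded_sub (Ub t.2) => y [].
  exists (map_mx ratr t.1), c => // x y [Ax Ux _] [_ _ Ey]; exact: Ey.
have [r r0 [L dL flat]] := sA y Ay.
have [B [BB LB _]] := orthonormal_basis dL.
have cone := flat_cone BB LB g01 flat.
have [|q qP] := @rat_matrix_dense R n j B^T (c / (n.+1%:R * j.+1%:R)).
  by rewrite divr_gt0// mulr_gt0// ltr0n.
have r20 : 0 < r / 2 by rewrite divr_gt0.
have [k [Uk Uky]] := Ubase y (r / 2) r20.
have [i Fi] := EF (q, k); exists i => //; rewrite Fi; split => // z Az Uz.
have := cone z Az (ltW (Uky z Uz)); set v := z - y => h1.
have := enorm_mulmx_small qP v; rewrite mulmxBr => h2.
have := enorm_sub (v *m B^T) (v *m map_mx ratr q).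
have h3 : n%:R * (j%:R * (c / (n.+1%:R * j.+1%:R))) <= c.
  have -> : n%:R * (j%:R * (c / (n.+1%:R * j.+1%:R))) =
     c * ((n%:R * j%:R) / (n.+1%:R * j.+1%:R)) :> R by ring.
  rewrite ger_pMr// ler_pdivrMr ?mulr_gt0 ?ltr0n// mul1r -!natrM ler_nat.
  by rewrite leq_mul.
have h4 := ler_wpM2r (enorm_ge0 v) h3.
have -> : c * enorm v = (1 - gamma) / 2 * enorm v - c * enorm v by rewrite /c; field.
by move: (le_trans h2 h4) h1 => /=; lra.
Qed.

Lemma sj_dim gamma n j (A : set 'rV[R]_n) : 0 < gamma < 1 -> sj gamma n j A ->
  dim_le R n j A.
Proof.
move=> g01 /(sj_pieces g01)[E [AE Ep]]; apply: pieces_dim AE _ => i.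
by have [] := Ep i; exact: colipschitz_minkowski.
Qed.

Lemma sj_rectifiable gamma n j (A : set 'rV[R]_n) : 0 < gamma < 1 -> sj gamma n j A ->
  rectifiable R n j A.
Proof.
by move=> g01 /(sj_pieces g01)[E [AE Ep]]; apply: pieces_rectifiable AE _ => i; have [] := Ep i.
Qed.

(** With the same L at all points of E, the coordinate map of L is co-Lipschitz
    on E. *)
Lemma flat_piece gamma n j (A E : set 'rV[R]_n) (L : {vspace 'rV[R]_n}) r :
  0 < gamma < 1 -> \dim L = j -> E `<=` A -> diam_le E (r / 2) ->
  (forall x, E x -> forall rho, 0 < rho <= r ->
     eball x rho `&` A `<=` nbhd_of (translate L x) (gamma * rho)) ->
  minkowski_finite j E.
Proof.
move=> g01 dL EA Er flat; have [B [BB LB _]] := orthonormal_basis dL.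
apply: colipschitz_minkowski; first exact: ebounded_diam_le Er.
exists B^T, ((1 - gamma) / 2) => [|x y Ex Ey]; first by move/andP: g01 => [_ ?]; lra.
exact: (flat_cone BB LB g01 (flat y Ey) (EA _ Ex) (Er _ _ Ex Ey)).
Qed.

Lemma srhoj_weakly gamma n j (A : set 'rV[R]_n) : 0 < gamma < 1 -> srhoj gamma n j A ->
  weakly_locally_finite R n j A.
Proof.
move=> g01 sA y Ay; have [r r0 [L dL flat]] := sA y Ay.
exists (r / 4); first by rewrite divr_gt0.
apply: minkowski_hausdorff_lty; apply: (@flat_piece gamma n j A _ L r g01 dL).
- exact: subIsetr.
- move=> x z [+ _] [+ _]; rewrite /eball/= => xr zr.
  by have := enorm_triangle y x z; rewrite (enormB y z); lra.
- move=> x [xr Ax]; apply: flat; split => //; move: xr; rewrite /eball/=; lra.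
Qed.

(** A bounded set is a finite union of pieces of diameter rho_0 / 2. *)
Lemma srho0j_minkowski gamma n j (A : set 'rV[R]_n) : 0 < gamma < 1 ->
  srho0j gamma n j A -> minkowski_finite j A.
Proof.
move=> g01 [r [r0 [z Az] [L dL flat]]].
have r20 : 0 < r / 2 by rewrite divr_gt0.
have [N [F [AF Fr]]] := ebounded_covered (ebounded_eball Az) r20.
apply: (minkowski_fin (E := fun i : 'I_N => F i `&` A)).
  by move=> x Ax; have [i Fi] := AF x Ax; exists i.
move=> i; apply: (@flat_piece gamma n j A _ L r g01 dL).
- exact: subIsetr.
- by move=> x y [Fx _] [Fy _]; exact: Fr Fx Fy.
- by move=> x [_ Ax]; exact: flat.
Qed.

(** Flatness for every gamma at a single radius, the same for all points. *)
Definition flat_at_scale n j (A : set 'rV[R]_n) (r : R) :=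
  forall gamma, 0 < gamma < 1 -> forall x, A x -> exists2 L, Gr R n j L &
    eball x r `&` A `<=` nbhd_of (translate L x) (gamma * r).

(** Since A fits in a ball of radius rho_0(gamma), half the distance of two fixed
    points of A is below rho_0(gamma) for all gamma, and serves as common scale.
    A set with at most one point is flat at every scale. *)
Lemma wrho0deltaj_scale n j (A : set 'rV[R]_n) : wrho0deltaj R n j A ->
  ebounded A /\ exists2 r, 0 < r & flat_at_scale j A r.
Proof.
move=> wA; split.
  have [|r [_ [z Az] _]] := wA (1 / 2); first by lra.
  exact: ebounded_eball Az.
have [[[x y] [/= Ax [Ay xy]]]|A1] := pselect (exists p, A p.1 /\ A p.2 /\ p.1 != p.2).
  have d0 : 0 < enorm (x - y) by rewrite enorm_gt0// subr_eq0.
  exists (enorm (x - y) / 2); first by rewrite divr_gt0.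
  move=> gamma g01 u Au; have [r [r0 [z Az] flat]] := wA _ g01.
  apply: flat => //; rewrite divr_gt0//=.
  move: (Az _ Ax) (Az _ Ay); rewrite /eball/= => xr yr.
  by have := enorm_triangle z x y; rewrite (enormB z y); lra.
exists 1 => // gamma g01 x Ax; have [r [r0 _ flat]] := wA _ g01.
have [|L dL _] := flat x Ax r; first by rewrite r0 lexx.
exists L => // z [_ Az]; apply/nbhd_translate; exists 0; first exact: mem0v.
have -> : z = x by apply: contra_notP A1 => /eqP zx; exists (z, x).
by rewrite subrr subr0 enorm0 mulr1; case/andP: g01.
Qed.

(** Being 1 / (M + 1)-flat at the fixed radius r, the piece lies within r / M of
    a plane, and M^j grid cells of that plane give a cover of mesh of order
    1 / M.  The plane may change with M. *)
Lemma flat_at_scale_minkowski n j (A E : set 'rV[R]_n) r : 0 < r ->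
  flat_at_scale j A r -> E `<=` A -> diam_le E (r / 2) -> minkowski_finite j E.
Proof.
move=> r0 flat EA Er.
have [[x Ex]|E0] := pselect (E !=set0); last first.
  exists 1 => // M _; exists 0%N; first by rewrite mulr_ge0// exprn_ge0.
  by exists (fun=> set0); split => [x Ex|i x y []]; case: E0; exists x.
pose K := j%:R * (2 * r) + 2 * r + 1.
have P0 : 0 <= j%:R * (2 * r) + 2 * r.
  by apply: addr_ge0; [apply: mulr_ge0; [exact: ler0n|lra]|lra].
have K0 : 0 < K by rewrite ltr_wpDl.
exists K => // M M0; exists (M ^ j)%N.
  by rewrite natrX ler_peMl ?exprn_ge0// /K lerDr.
have M1 : 0 < M%:R :> R by rewrite ltr0n.
pose g : R := (M.+1%:R)^-1.
have gM : g <= M%:R^-1 by rewrite lef_pV2 ?posrE ?ltr0n// ler_nat.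
have g01 : 0 < g < 1 by rewrite invr_gt0 ltr0n invf_lt1 ?ltr0n// ltr1n ltnS.
have [L dL Lflat] := flat g g01 x (EA _ Ex).
have [B [BB LB _]] := orthonormal_basis dL.
have perp z : E z -> enorm ((z - x) - (z - x) *m B^T *m B) <= r / M%:R.
  move=> Ez; apply/ltW/(@lt_le_trans _ _ (g * r)).
    apply: (nbhd_onb BB LB); apply: Lflat; split; last exact: EA.
    by apply: le_lt_trans (Er _ _ Ez Ex) _; lra.
  by rewrite mulrC ler_pM2l.
have Er' z : E z -> enorm (z - x) <= r by move=> Ez; apply: le_trans (Er _ _ Ez Ex) _; lra.
apply: covered_weak (flat_covered M0 r0 BB Er' perp) (@subset_refl _ _) _.
have -> : K / M%:R = j%:R * (2 * r / M%:R) + 2 * (r / M%:R) + M%:R^-1.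
  by rewrite /K; field; rewrite gt_eqF.
by rewrite lerDl invr_ge0.
Qed.

Lemma wrho0deltaj_minkowski n j (A : set 'rV[R]_n) : wrho0deltaj R n j A ->
  minkowski_finite j A.
Proof.
move=> /wrho0deltaj_scale[Ab [r r0 flat]].
have r20 : 0 < r / 2 by rewrite divr_gt0.
have [N [F [AF Fr]]] := ebounded_covered Ab r20.
apply: (minkowski_fin (E := fun i : 'I_N => F i `&` A)).
  by move=> x Ax; have [i Fi] := AF x Ax; exists i.
move=> i; apply: (flat_at_scale_minkowski r0 flat); first exact: subIsetr.
by move=> x y [Fx _] [Fy _]; exact: Fr Fx Fy.
Qed.

End YesAnswers.

(** * Positive answers: exact planes and dimension *)

Section WeakYes.
Variable R : realType.
Implicit Types n m j : nat.

(** The piece lies in a single plane through x.  Let S be the set of vectors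
    whose distance to the plane of parameter g is O(g) as g tends to 0.  It is a
    linear subspace containing E - x.  A subspace U of S has dimension at most
    j: otherwise the projection to each plane would kill a nonzero vector of U,
    which would then be at distance |u| from the plane, against O(g) |u|.  A
    subspace U of S of maximal dimension contains S, and the coordinates in U,
    padded with zeros, are isometric on E. *)
Lemma flat_at_scale_colipschitz n j (A E : set 'rV[R]_n) r : 0 < r ->
  flat_at_scale j A r -> E `<=` A -> diam_le E (r / 2) -> colipschitz j E.
Proof.
move=> r0 flat EA Er.
have [[x Ex]|E0] := pselect (E !=set0); last first.
  by exists 0, 1 => // x y Ex; case: E0; exists x.
have /choice[B BP] : forall g : R, exists B : 'M[R]_(j, n), 0 < g < 1 ->
    B *m B^T = 1%:M /\ forall z, E z -> enorm ((z - x) - (z - x) *m B^T *m B) <= r * g.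
  move=> g; have [g01|_] := boolP (0 < g < 1); last by exists 0.
  have [L dL Lflat] := flat g g01 x (EA _ Ex).
  have [B [BB LB _]] := orthonormal_basis dL.
  exists B => _; split=> // z Ez; rewrite mulrC ltW//; apply: (nbhd_onb BB LB).
  apply: Lflat; split; last exact: EA.
  by apply: le_lt_trans (Er _ _ Ez Ex) _; lra.
pose S (v : 'rV[R]_n) := exists C : R, forall g, 0 < g < 1 ->
  enorm (v - v *m (B g)^T *m B g) <= C * g.
have S0 : S 0 by exists 0 => g _; rewrite !mul0mx subrr enorm0 mul0r.
have SD a u v : S u -> S v -> S (a *: u + v).
  move=> [Cu uP] [Cv vP]; exists (`|a| * Cu + Cv) => g g01.
  rewrite !mulmxDl -!scalemxAl opprD addrACA -scalerBr.
  apply: le_trans (enormD _ _) _; rewrite enormZ mulrDl lerD ?vP//.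
  by rewrite -mulrA ler_wpM2l// uP.
have SE z : E z -> S (z - x) by move=> Ez; exists r => g /BP[_]; exact.
pose P d := `[< exists U : {vspace 'rV[R]_n}, \dim U = d /\ forall u, u \in U -> S u >].
have exP : exists d, P d.
  exists 0%N; apply/asboolP; exists 0%VS; rewrite dimv0; split => // u.
  by rewrite memv0 => /eqP ->.
have Pn d : P d -> (d <= n)%N.
  move=> /asboolP[U [<- _]]; apply: leq_trans (dimvS (subvf U)) _.
  by rewrite dimvf /dim/= mul1n.
have [d /asboolP[U [dU US]] maxd] := ex_maxnP exP Pn.
have SU v : S v -> v \in U.
  move=> Sv; have : P (\dim (U + <[v]>)%VS).
    apply/asboolP; exists (U + <[v]>)%VS; split => // _ /memv_addP[u uU [w /vlineP[a ->] ->]].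
    by rewrite addrC; apply: SD => //; exact: US.
  move=> /maxd; rewrite -dU => dd.
  have : (U == U + <[v]>)%VS by rewrite eqEdim addvSl.
  by move=> /eqP ->; apply/(subvP (addvSr U _))/memv_line.
have [BU [BUU UB BUin]] := orthonormal_basis dU.
have dj : (d <= j)%N.
  rewrite leqNgt; apply/negP => jd.
  have /choice[C CP] : forall i : 'I_d, exists C : R, forall g, 0 < g < 1 ->
      enorm (row i BU - row i BU *m (B g)^T *m B g) <= C * g.
    by move=> i; have [C ?] := US _ (BUin (delta_mx 0 i)); exists C => g; rewrite rowE; auto.
  pose K := 2 + \sum_i `|C i|.
  have K0 : 2 <= K by rewrite lerDl sumr_ge0.
  (* any parameter below the inverse of the sum of the constants |C i| will do *)
  have g01 : 0 < K^-1 < 1 by rewrite invr_gt0 invf_lt1; lra.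
  set g := K^-1 in g01; have [BB _] := BP g g01.
  have : kermx (BU *m (B g)^T) != 0.
    rewrite -mxrank_eq0 mxrank_ker subn_eq0 -ltnNge.
    by apply: leq_ltn_trans (rank_leq_col _) jd.
  move=> /rowV0Pn[w /sub_kermxP wk w0].
  have : enorm (w *m BU) <= (\sum_i `|C i|) * g * enorm w.
    have -> : w *m BU = w *m (BU - BU *m (B g)^T *m B g).
      by rewrite mulmxBr mulmxA wk mul0mx subr0.
    rewrite mulmx_sum_row.
    apply: le_trans (enorm_sum _ _ _) _; rewrite -mulrA mulr_suml; apply: ler_sum => i _.
    rewrite enormZ linearB/= !row_mul mulrA [leRHS]mulrC.
    apply: ler_pM; rewrite ?enorm_ge0 ?enorm_coord//.
    apply: le_trans (CP i g g01) _; rewrite ler_pM2r ?ler_norm//.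
    by case/andP: g01.
  rewrite enorm_onb// -[leLHS]mul1r ler_pM2r ?enorm_gt0// /g ler_pdivlMr; last by lra.
  by rewrite /K; lra.
(* O pads coordinates in U with zeros up to length j *)
pose O : 'M[R]_(d, j) := pid_mx d.
have OO : O *m O^T = 1%:M by rewrite tr_pid_mx mul_pid_mx !minnn (minn_idPr dj) pid_mx_1.
exists (BU^T *m O), 1 => // y z Ey Ez.
have : y - z \in U.
  have -> : y - z = (y - x) - (z - x) by rewrite opprB addrA subrK.
  by apply: memvB; apply/SU/SE.
by move=> /UB yzU; rewrite mul1r mulmxA (enorm_onb _ OO) -(enorm_onb _ BUU) yzU.
Qed.

Lemma wrho0deltaj_rectifiable n j (A : set 'rV[R]_n) : wrho0deltaj R n j A ->
  rectifiable R n j A.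
Proof.
move=> /wrho0deltaj_scale[Ab [r r0 flat]].
have r20 : 0 < r / 2 by rewrite divr_gt0.
have [N [F [AF Fr]]] := ebounded_covered Ab r20.
pose E i : set 'rV[R]_n := if insub i is Some k then F k `&` A else set0.
apply: (@pieces_rectifiable R n j A E).
  by move=> x Ax; have [i Fi] := AF x Ax; exists i => //; rewrite /E valK.
move=> i; rewrite /E; case: insubP => [k _ _|_]; last exact: colipschitz_set0.
apply: (flat_at_scale_colipschitz r0 flat); first exact: subIsetr.
by move=> x y [Fx _] [Fy _]; exact: Fr Fx Fy.
Qed.

(** The hypothesis on all subsets of E lets each set of a cover be subdivided
    again. *)
Lemma covered_iter n (E : set 'rV[R]_n) N theta d : 0 < theta <= 1 -> 0 < d ->
  (forall F t, F `<=` E -> 0 < t <= d -> diam_le F t -> covered F N (theta * t)) ->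
  diam_le E d -> forall k, covered E (N ^ k) (theta ^+ k * d).
Proof.
move=> /andP[t0 t1] d0 H Ed; elim => [|k [F [EF Fk]]].
  by exists (fun=> E); split => [x Ex|i]; [exists ord0|rewrite mul1r].
have /choice[G GP] : forall i, exists G : 'I_N -> set 'rV[R]_n,
    (forall x, (F i `&` E) x -> exists l, G l x) /\
    forall l, diam_le (G l) (theta * (theta ^+ k * d)).
  move=> i; apply: H => [x []//||x y [Fx _] [Fy _]]; last exact: Fk Fx Fy.
  by rewrite mulr_gt0 ?exprn_gt0//= ler_piMl ?(ltW d0)// exprn_ile1 ?(ltW t0).
have -> : (N ^ k.+1)%N = #|{: 'I_(N ^ k) * 'I_N}| by rewrite card_prod !card_ord expnSr.
apply: (covered_fin (F := fun p : 'I_(N ^ k) * 'I_N => G p.1 p.2)).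
  move=> x Ex; have [i Fi] := EF x Ex; have [l Gl] := (GP i).1 x (conj Fi Ex).
  by exists (i, l).
by move=> [i l]; rewrite exprS -mulrA; exact: (GP i).2.
Qed.

Lemma half_expr_small (c e : R) : 0 <= c -> 0 < e -> exists k, (1 / 2) ^+ k * c <= e.
Proof.
move=> c0 e0; exists (Num.truncn (c / e)).+1; set k := _.+1.
rewrite expr_div_n expr1n mul1r mulrC ler_pdivrMr ?exprn_gt0//.
rewrite mulrC -ler_pdivrMr//; apply: le_trans (ltW (truncnS_gt _)) _.
by rewrite -natrX ler_nat ltnW// ltn_expl.
Qed.

(** A set of diameter t is flat at radius 2 t; its M^j grid cells have diameter
    2 j t / M along the plane and 4 t / M across it. *)
Lemma wj_covered n j (A F : set 'rV[R]_n) (M : nat) r t : (0 < M)%N -> F `<=` A ->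
  (forall x, F x -> forall rho, 0 < rho <= r -> exists2 L, Gr R n j L &
     eball x rho `&` A `<=` nbhd_of (translate L x) (M%:R^-1 * rho)) ->
  0 < t <= r / 2 -> diam_le F t -> covered F (M ^ j) ((2 * j%:R + 4) / M%:R * t).
Proof.
move=> M0 FA flat /andP[t0 tr] Ft.
have [[x Fx]|F0] := pselect (F !=set0); last first.
  exists (fun=> set0); split => [x Fx|i x y []]; case: F0; exists x; exact: Fx.
have M1 : 0 < M%:R :> R by rewrite ltr0n.
have [|L dL Lflat] := flat x Fx (2 * t); first by lra.
have [B [BB LB _]] := orthonormal_basis dL.
have perp z : F z -> enorm ((z - x) - (z - x) *m B^T *m B) <= M%:R^-1 * (2 * t).
  move=> Fz; apply/ltW; apply: (nbhd_onb BB LB); apply: Lflat; split; last exact: FA.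
  by apply: le_lt_trans (Ft _ _ Fz Fx) _; lra.
have Ftx z : F z -> enorm (z - x) <= t by move=> Fz; exact: Ft.
apply: covered_weak (flat_covered M0 t0 BB Ftx perp) (@subset_refl _ _) _.
by rewrite le_eqVlt; apply/orP; left; apply/eqP; field; rewrite gt_eqF.
Qed.

(** Fix s > j and K = 2 j + 4, and take gamma = 1 / M with M^j (K / M)^s <= 1/2
    and K / M <= 1/2.  On the set of points of A that are 1/M-flat up to a given
    radius, intersected with a ball of small diameter, iterate [wj_covered]:
    after l steps the s-sum is at most 2^-l d^s. *)
Lemma wdeltaj_dim n j (A : set 'rV[R]_n) : wdeltaj R n j A -> dim_le R n j A.
Proof.
move=> wA; apply: dim_leP => s js.
have s0 : 0 < s by apply: le_lt_trans js; rewrite ler0n.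
pose K : R := 2 * j%:R + 4.
have K4 : 4 <= K by rewrite lerDr mulr_ge0.
have K0 : 0 < K by lra.
have half0 : 0 < 1 / 2 :> R by lra.
have [y yP] := exponent_gap js K0 half0.
pose M := (Num.truncn (Num.max (2 * K) y)).+1.
have /andP[M2K yM] : (2 * K <= M%:R) && (y <= M%:R) by rewrite -ge_max ltW// truncnS_gt.
have M1 : 0 < M%:R :> R by rewrite ltr0n.
pose theta := K / M%:R.
have th0 : 0 < theta by rewrite divr_gt0.
have th1 : theta <= 1 / 2 by rewrite ler_pdivrMr//; lra.
have q1 : M%:R ^+ j * theta `^ s <= 1 / 2 by exact: yP.
have g01 : 0 < (M%:R^-1 : R) < 1 by rewrite invr_gt0 M1 invf_lt1//=; lra.
have [U [_ Ubase]] := countable_base R n.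
pose flat_upto m x := forall rho : R, 0 < rho <= m.+1%:R^-1 -> exists2 L, Gr R n j L &
     eball x rho `&` A `<=` nbhd_of (translate L x) (M%:R^-1 * rho).
pose E (p : nat * nat) := [set x | [/\ A x, U p.2 x, flat_upto p.1 x &
   diam_le (U p.2) (p.1.+1%:R^-1 / 2)]].
have [F [EF FE]] := countable_family E.
have AF : A `<=` \bigcup_i F i.
  move=> x Ax; have [r r0 rP] := wA _ g01 x Ax.
  pose m := Num.truncn r^-1; have m0 : 0 < m.+1%:R :> R by rewrite ltr0n.
  have mr : m.+1%:R^-1 <= r by rewrite -[leRHS]invrK lef_pV2 ?posrE ?invr_gt0// ltW// truncnS_gt.
  have [|k [Uk Ukx]] := Ubase x (m.+1%:R^-1 / 4); first by rewrite divr_gt0// invr_gt0.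
  have [i Fi] := EF (m, k); exists i => //; rewrite Fi; split => //.
    by move=> rho /andP[rho0 rhom]; apply: rP; rewrite rho0 (le_trans rhom).
  move=> a b /Ukx ax /Ukx bx; have := enorm_triangle x a b; rewrite (enormB x b).
  by move: ax bx => /=; move: (m.+1%:R^-1) => u; lra.
apply: hausdorff_null_sub AF _; apply: hausdorff_null_bigcup => i.
have [->|[[m k] ->]] := FE i; first by rewrite hausdorff_set0// ltW.
have [Uk|Uk] := pselect (diam_le (U k) (m.+1%:R^-1 / 2)); last first.
  rewrite (_ : E _ = set0) ?hausdorff_set0 ?(ltW s0)//.
  by apply/seteqP; split => // x [].
pose d : R := m.+1%:R^-1 / 2.
have d0 : 0 < d by rewrite divr_gt0// invr_gt0 ltr0n.
have cov : forall l, covered (E (m, k)) ((M ^ j) ^ l) (theta ^+ l * d).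
  apply: covered_iter => //.
  - by rewrite th0; lra.
  - move=> G t GE td Gt; apply: (@wj_covered n j A G M m.+1%:R^-1) => //.
      by move=> x /GE[].
    by move=> x /GE[].
  - by move=> a b [_ Ua _ _] [_ Ub _ _]; exact: Uk.
apply: hausdorff_null_covered => [|e e0]; first exact: ltW.
have [|l lP] := @half_expr_small (d `^ s + d) e _ e0.
  by rewrite addr_ge0 ?powR_ge0// ltW.
have hl : 0 <= (1 / 2 : R) ^+ l by rewrite exprn_ge0.
exists ((M ^ j) ^ l)%N, (theta ^+ l * d); split => //.
  rewrite mulr_ge0 ?exprn_ge0 ?(ltW th0) ?(ltW d0)//=; apply: le_trans lP.
  apply: ler_pM; rewrite ?exprn_ge0 ?(ltW th0) ?(ltW d0) ?lerDr ?powR_ge0//.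
  by rewrite lerXn2r ?nnegrE ?(ltW th0).
rewrite powRM ?exprn_ge0 ?(ltW th0) ?(ltW d0)//.
rewrite -powR_mulrn ?(ltW th0)// -powRrM mulrC [_ * s]mulrC powRrM powR_mulrn ?powR_ge0//.
rewrite mulrC mulrA !natrX -exprMn; apply: le_trans lP.
apply: ler_pM; rewrite ?exprn_ge0 ?mulr_ge0 ?exprn_ge0 ?powR_ge0 ?lerDl ?(ltW d0)//.
by rewrite lerXn2r ?nnegrE ?mulr_ge0 ?exprn_ge0 ?powR_ge0.
Qed.

End WeakYes.

(** * Lower bounds on Hausdorff measure *)

Section Mass.
Variable R : realType.
Implicit Types n m j : nat.

(** Lebesgue outer measure: being monotone and subadditive on arbitrary sets, it
    applies to preimages under p without any measurability of p. *)
Definition leb (X : set R) : \bar R := lebesgue_measure X.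

Lemma leb_le (X Y : set R) : X `<=` Y -> (leb X <= leb Y)%E.
Proof. by move=> XY; apply: le_mu_ext. Qed.

Lemma leb_ge0 (X : set R) : (0 <= leb X)%E.
Proof. exact: measure_ge0. Qed.

Lemma leb_bigcup (X : nat -> set R) : (leb (\bigcup_i X i) <= \sum_(i <oo) leb (X i))%E.
Proof. by apply: mu_ext_sigma_subadditive => Y; exact: wlength_ge0. Qed.

Lemma leb_null_bigcup (X : nat -> set R) : (forall i, leb (X i) = 0%E) ->
  leb (\bigcup_i X i) = 0%E.
Proof.
move=> X0; apply/eqP; rewrite eq_le leb_ge0 andbT; apply: le_trans (leb_bigcup _) _.
by rewrite eseries0.
Qed.

Lemma leb_itv (a b : R) : a <= b -> leb `[a, b]%classic = (b - a)%:E.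
Proof.
rewrite /leb lebesgue_measure_itv/= lte_fin le_eqVlt => /predU1P[->|ab].
  by rewrite ltxx subrr.
by rewrite ab -EFinB.
Qed.

(** If parameters at small distance in the image are close with exponent sigma,
    then a set F of diameter d occupies parameters inside an interval of length
    2 C d^sigma.  Sum over a cover. *)
Lemma mass_distribution n (p : R -> 'rV[R]_n) (T : set R) sigma delta C (E : set 'rV[R]_n) :
  0 <= sigma -> 0 < C ->
  (forall s t, T s -> T t -> enorm (p s - p t) <= delta ->
    `|s - t| <= C * enorm (p s - p t) `^ sigma) ->
  (leb (T `&` p @^-1` E) <= (2 * C)%:E * hausdorff_pre sigma delta E)%E.
Proof.
move=> s0 C0 H; rewrite /hausdorff_pre -ereal_inf_pZl ?mulr_gt0//.
apply: le_ereal_inf_tmp => _ [_ [F [EF Fd] <-] <-].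
rewrite -nneseriesZl; last by move=> *; exact: diam_pow_ge0.
apply: (@le_trans _ _ (leb (\bigcup_k (T `&` p @^-1` F k)))).
  by apply: leb_le => t [Tt /EF[k _ Fk]]; exists k.
apply: le_trans (leb_bigcup _) _; apply: lee_nneseries => [k _ _|k _]; first exact: leb_ge0.
have [[s [Ts Fs]]|X0] := pselect ((T `&` p @^-1` F k) !=set0); last first.
  have -> : T `&` p @^-1` F k = set0 by apply/seteqP; split => // t Xt; case: X0; exists t.
  rewrite /leb measure0 mule_ge0 ?lee_fin ?mulr_ge0 ?(ltW C0)//; exact: diam_pow_ge0.
have Fk0 : F k !=set0 by exists (p s).
have d0 := ediam_ge0 Fk0; have dd := Fd k.
rewrite /diam_pow ifF; last by apply/negbTE/set0P.
case E1 : (ediam (F k)) d0 dd => [d| |] //; rewrite !lee_fin => d0 dd.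
have Fkd : diam_le (F k) d by apply/ediamP; rewrite E1.
have pd : 0 <= d `^ sigma by exact: powR_ge0.
apply: (@le_trans _ _ (leb `[s - C * d `^ sigma, s + C * d `^ sigma]%classic)).
  apply: leb_le => t [Tt Ft]; rewrite /= in_itv/= -ler_distlC.
  have pst : enorm (p s - p t) <= d by exact: Fkd.
  apply: le_trans (H _ _ Ts Tt (le_trans pst dd)) _; rewrite ler_pM2l//.
  by apply: ge0_ler_powR; rewrite ?nnegrE ?enorm_ge0.
have Cd : 0 <= C * d `^ sigma by rewrite mulr_ge0 ?(ltW C0).
rewrite leb_itv; last by lra.
by rewrite poweR_EFin -EFinM lee_fin; lra.
Qed.

Lemma ebounded_compact n (A : set 'rV[R]_n) : ebounded A ->
  exists2 K : set 'rV[R]_n, compact K & A `<=` K.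
Proof.
move=> [S AS]; exists [set v : 'rV[R]_n | forall i, `[- S, S]%classic (v ord0 i)].
  by apply: (@rV_compact _ _ (fun=> `[- S, S]%classic)) => _; exact: segment_compact.
by move=> v /AS vS i; rewrite /= in_itv/= -ler_norml; apply: le_trans (enorm_coord _ _) vS.
Qed.

(** If the dimension were at most j, some exponent u < sigma would give measure 0.
    At distances at most 1 the Hoelder bound with exponent sigma implies the one
    with exponent u, so the parameter set would be null. *)
Lemma holder_not_dim_le n j (p : R -> 'rV[R]_n) (T : set R) sigma C : j%:R < sigma -> 0 < C ->
  (forall s t, T s -> T t -> enorm (p s - p t) <= 1 ->
    `|s - t| <= C * enorm (p s - p t) `^ sigma) ->
  (0 < leb T)%E -> ~ dim_le R n j (p @` T).
Proof.
move=> js C0 H T0 dimA.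
have s0 : 0 < sigma by apply: le_lt_trans js; rewrite ler0n.
have : (hausdorff_dim (p @` T) < sigma%:E)%E.
  by apply: le_lt_trans dimA _; rewrite lte_fin.
move=> /ereal_inf_lt[_ [u [u0 uH] <-]]; rewrite lte_fin => us.
have := @mass_distribution _ p T u 1 C (p @` T) u0 C0.
rewrite (hausdorff_eq0P _ _).1// mule0 => M.
move: T0; rewrite ltNge => /negP; apply.
have TT : T `<=` T `&` p @^-1` (p @` T) by move=> t Tt; split => //; exists t.
apply: le_trans (leb_le TT) _; apply: M => s t Ts Tt pst.
apply: le_trans (H _ _ Ts Tt pst) _; rewrite ler_pM2l//.
have [->|d0] := eqVneq (enorm (p s - p t)) 0.
  by rewrite powR0 ?gt_eqF ?powR_ge0.
by apply: ger_powR; [rewrite lt_def d0 enorm_ge0|exact: ltW].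
Qed.

(** The inverse of p is infinitesimally Lipschitz with constant 0. *)
Definition expanding n (p : R -> 'rV[R]_n) (T : set R) := forall e, 0 < e ->
  exists2 delta, 0 < delta & forall s t, T s -> T t -> enorm (p s - p t) <= delta ->
    `|s - t| <= e * enorm (p s - p t).

(** In [mass_distribution] with sigma = 1 the constant can be made arbitrarily
    small, against a finite measure. *)
Lemma expanding_null n (p : R -> 'rV[R]_n) (T : set R) (E : set 'rV[R]_n) :
  expanding p T -> (hausdorff 1 E < +oo)%E -> leb (T `&` p @^-1` E) = 0%E.
Proof.
move=> pT Ey; apply/eqP; rewrite eq_le leb_ge0 andbT.
have H0 := hausdorff_ge0 1 E.
case E1 : (hausdorff 1 E) Ey H0 => [h| |] // _; rewrite lee_fin => h0.
apply/lee_addgt0Pr => e e0; rewrite add0e.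
have h1 : 0 < 2 * (h + 1) by lra.
have h10 : h + 1 != 0 by rewrite gt_eqF//; lra.
have [|delta d0 dP] := pT (e / (2 * (h + 1))); first by rewrite divr_gt0.
have e1 : 0 < e / (2 * (h + 1)) by rewrite divr_gt0.
have M : (leb (T `&` p @^-1` E) <=
    (2 * (e / (2 * (h + 1))))%:E * hausdorff_pre 1 delta E)%E.
  by apply: mass_distribution => // s t Ts Tt pst; rewrite powRr1 ?enorm_ge0// dP.
apply: (le_trans M); apply: (@le_trans _ _ ((2 * (e / (2 * (h + 1))))%:E * h%:E)%E).
  apply: lee_wpmul2l; first by rewrite lee_fin mulr_ge0// ltW.
  by rewrite -E1; exact: hausdorff_pre_le_hausdorff.
rewrite -EFinM lee_fin.
have -> : 2 * (e / (2 * (h + 1))) * h = e * (h / (h + 1)) by field.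
by rewrite ler_piMr ?(ltW e0)// ler_pdivrMr; clear M; lra.
Qed.

Lemma expanding_not_sigma_finite n (p : R -> 'rV[R]_n) (T : set R) (E : nat -> set 'rV[R]_n) :
  expanding p T -> (0 < leb T)%E -> (forall i, hausdorff 1 (E i) < +oo)%E ->
  ~ (p @` T `<=` \bigcup_i E i).
Proof.
move=> pT T0 Efin AE; move: T0; rewrite ltNge => /negP; apply.
apply: (@le_trans _ _ (leb (\bigcup_i (T `&` p @^-1` E i)))).
  by apply: leb_le => t Tt; have [i _ Ei] := AE (p t) (ex_intro2 _ _ t Tt erefl); exists i.
by rewrite leb_null_bigcup// => i; exact: expanding_null.
Qed.

Lemma expanding_not_strongly n (p : R -> 'rV[R]_n) (T : set R) : expanding p T ->
  (0 < leb T)%E -> ebounded (p @` T) -> ~ strongly_locally_finite R n 1 (p @` T).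
Proof.
move=> pT T0 /ebounded_compact[K cK AK] /(_ K cK) Kfin.
apply: (@expanding_not_sigma_finite n p T (fun=> K `&` p @` T)) => //.
by move=> x Ax; exists 0%N => //; split => //; exact: AK.
Qed.

(** By the countable base, weak local finiteness would make the image
    sigma-finite. *)
Lemma expanding_not_weakly n (p : R -> 'rV[R]_n) (T : set R) : expanding p T ->
  (0 < leb T)%E -> ~ weakly_locally_finite R n 1 (p @` T).
Proof.
move=> pT T0 wA; have [U [_ Ubase]] := countable_base R n.
pose E k : set 'rV[R]_n := if `[< (hausdorff 1 (U k `&` p @` T) < +oo)%E >]
  then U k `&` p @` T else set0.
apply: (@expanding_not_sigma_finite n p T E) => //.
  move=> k; rewrite /E; case: ifP => [/asboolP//|_].
  by rewrite hausdorff_set0 ?ltry.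
move=> x Ax; have [r r0 rfin] := wA x Ax.
have [k [Ukx Uk]] := Ubase x r r0; exists k => //; rewrite /E ifT//.
apply/asboolP; apply: le_lt_trans rfin; apply: hausdorff_le => y [Uy Ay].
by split => //; exact: Uk.
Qed.

(** A Lipschitz image of R is a countable union of Lipschitz images of bounded
    intervals, each of finite length. *)
Lemma expanding_not_rectifiable n (p : R -> 'rV[R]_n) (T : set R) : expanding p T ->
  (0 < leb T)%E -> ~ rectifiable R n 1 (p @` T).
Proof.
move=> pT T0 [M0 [f [M00 fL AM]]].
pose D (q : option (nat * nat)) : set 'rV[R]_n :=
  if q is Some (i, k) then f i @` [set w | enorm w <= k%:R] else M0.
have [E [DE ED]] := countable_family D.
apply: (@expanding_not_sigma_finite n p T E) => //.
  move=> i; have [->|[[[l k]|] ->]] := ED i.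
  - by rewrite hausdorff_set0 ?ltry.
  - exact: minkowski_hausdorff_lty (lipschitz_minkowski _ (fL l)).
  - by rewrite /= M00 ltry.
move=> x /AM[M0x|[i _ [w _ <-]]].
  by have [k Ek] := DE None; exists k => //; rewrite Ek.
have [k Ek] := DE (Some (i, (Num.truncn (enorm w)).+1)); exists k => //; rewrite Ek.
by exists w => //=; rewrite ltW// truncnS_gt.
Qed.

End Mass.

(** * The stripes *)

Section Stripes.
Variable R : realType.

Definition pt (x y : R) : 'rV[R]_2 := \row_i (if i == 0 then x else y).

Lemma dot2 (u v : 'rV[R]_2) : dot u v = u 0 0 * v 0 0 + u 0 1 * v 0 1.
Proof. by rewrite /dot !big_ord_recl big_ord0 addr0; congr (_ * _ + _ * _); congr (_ _ _); apply: val_inj. Qed.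

Lemma ptB x y x' y' : pt x y - pt x' y' = pt (x - x') (y - y').
Proof. by apply/rowP => i; rewrite !mxE; case: ifP. Qed.

Lemma ptZ a x y : a *: pt x y = pt (a * x) (a * y).
Proof. by apply/rowP => i; rewrite !mxE; case: ifP. Qed.

Lemma enorm_pt_le x y : enorm (pt x y) <= `|x| + `|y|.
Proof.
have -> : pt x y = pt x 0 + pt 0 y.
  by apply/rowP => i; rewrite !mxE; case: ifP; rewrite ?addr0 ?add0r.
apply: le_trans (enormD _ _) _; rewrite lerD// enormP// dot2 !mxE /= real_normK ?num_real//; lra.
Qed.

Lemma enorm_pt0 x : enorm (pt x 0) = `|x|.
Proof.
apply/eqP; rewrite -(@eqrXn2 _ 2) ?enorm_ge0// enorm_sqr dot2 !mxE/=.
by rewrite mulr0 addr0 real_normK ?num_real// expr2.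
Qed.

Lemma enorm_pt_ge x y : `|x| <= enorm (pt x y) /\ `|y| <= enorm (pt x y).
Proof.
by have := enorm_coord (pt x y) 0; have := enorm_coord (pt x y) 1; rewrite !mxE.
Qed.

Definition height (k : nat) : R := (1 / 4) ^+ k.

(** The left ends lie on the parabola y = x^2, which makes the set tangent to the
    horizontal axis at 0. *)
Definition stripes : set 'rV[R]_2 :=
  [set v | exists k x, (1 / 2) ^+ k <= x <= 1 /\ v = pt x (height k)].

Lemma height_gt0 k : 0 < height k.
Proof. by rewrite exprn_gt0. Qed.

Lemma height_lt k l : (k < l)%N -> height l <= height k / 4.
Proof.
move=> kl; rewrite -[l](subnKC kl) /height exprD exprSr mulrAC mulrA mulr1.
by rewrite ler_pM2r ?invr_gt0// ler_piMr ?exprn_ge0// exprn_ile1//; lra.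
Qed.

Lemma height_sep k l : `|height k - height l| < height k / 2 -> k = l.
Proof.
have hk := height_gt0 k; have hl := height_gt0 l.
rewrite ltr_norml; case: (ltngtP k l) => // /height_lt h /andP[h1 h2]; exfalso; lra.
Qed.

(** Heights differ by a factor 4, so a ball of radius half the height of its
    centre meets one stripe only. *)
Lemma stripes_line u z : stripes u -> stripes z -> enorm (z - u) < u 0 1 / 2 ->
  exists x, z - u = pt x 0.
Proof.
move=> [k [x [_ ->]]] [l [x' [_ ->]]]; rewrite ptB mxE/= => d.
have [_ h] := enorm_pt_ge (x' - x) (height l - height k).
have /height_sep -> : `|height k - height l| < height k / 2 by rewrite distrC (le_lt_trans h).
by exists (x' - x); rewrite subrr.
Qed.

Lemma dim_horizontal : \dim <[pt 1 0]>%VS = 1%N.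
Proof.
rewrite dim_vline; case: eqP => // /rowP/(_ 0); rewrite !mxE/= => /eqP.
by rewrite oner_eq0.
Qed.

Lemma horizontal x : pt x 0 \in <[pt 1 0]>%VS.
Proof. by apply/vlineP; exists x; rewrite ptZ mulr1 mulr0. Qed.

Lemma stripes_flat (A : set 'rV[R]_2) u gamma rho : 0 < gamma -> 0 < rho ->
  (forall z, A z -> enorm (z - u) < rho -> exists x, z - u = pt x 0) ->
  eball u rho `&` A `<=` nbhd_of (translate <[pt 1 0]>%VS u) (gamma * rho).
Proof.
move=> g0 rho0 H z [uz Az]; have [x zx] := H z Az uz; apply/nbhd_translate.
by exists (pt x 0); [exact: horizontal|rewrite zx subrr enorm0 mulr_gt0].
Qed.

Lemma stripes_srhodelta : srhodeltaj R 2 1 stripes.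
Proof.
move=> gamma /andP[g0 g1] u [k [x0 [_ ->]]]; have h0 := height_gt0 k.
exists (height k / 8); first by rewrite divr_gt0.
exists <[pt 1 0]>%VS; first exact: dim_horizontal.
move=> v [uv Av] rho /andP[rho0 rhok]; apply: stripes_flat => // z Az zv.
apply: stripes_line => //; apply: lt_le_trans zv _; apply: le_trans rhok _.
move: uv; rewrite /eball/=.
have := enorm_coord (v - pt x0 (height k)) 1; rewrite !mxE/= ler_norml; lra.
Qed.

(** At 0 a point of norm below rho has height at most x^2 < rho^2, and
    rho^2 <= gamma rho once rho <= gamma. *)
Lemma stripes0_sdelta : sdeltaj R 2 1 (0 |` stripes).
Proof.
move=> gamma /andP[g0 g1] u [->|[k [x0 [xk ->]]]]; last first.
  have h0 := height_gt0 k.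
  exists (height k / 4); first by rewrite divr_gt0.
  exists <[pt 1 0]>%VS; first exact: dim_horizontal.
  move=> rho /andP[rho0 rhok]; apply: stripes_flat => // z [->|Az] zv.
    have := enorm_coord (0 - pt x0 (height k)) 1; rewrite !mxE/= ler_norml => Hn.
    by exfalso; move: zv Hn rhok; lra.
  apply: stripes_line => //; first by exists k, x0.
  by rewrite mxE/=; move: zv; lra.
exists gamma => //; exists <[pt 1 0]>%VS; first exact: dim_horizontal.
move=> rho /andP[rho0 rhog] z [+ zA]; rewrite /eball/= subr0 => zr.
apply/nbhd_translate; rewrite subr0; case: zA zr => [->|[k [x [/andP[kx x1] ->]]]] zr.
  by exists 0; [exact: mem0v|rewrite subr0 enorm0 mulr_gt0].
exists (pt x 0); first exact: horizontal.
rewrite ptB subrr subr0; apply: le_lt_trans (enorm_pt_le _ _) _.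
have h0 := height_gt0 k; rewrite normr0 add0r gtr0_norm//.
have [xr _] := enorm_pt_ge x (height k).
have x0 : 0 < x by apply: lt_le_trans kx; rewrite exprn_gt0.
rewrite gtr0_norm// in xr.
have hx : height k <= x ^+ 2.
  rewrite /height (_ : 1 / 4 = (1 / 2) ^+ 2); last by field.
  by rewrite -exprM mulnC exprM lerXn2r ?nnegrE ?exprn_ge0// ltW.
by nra.
Qed.

(** Within distance r of 0 every stripe from some level k on contains the
    segment r/4 <= x <= r/2.  Lay the first N of these segments end to end along
    the interval [0, N]; at distances below the gap between stripes this
    parametrisation stretches by the factor r/4, so the measure is at least of
    order r N, for every N. *)
Lemma stripes_infinite r : 0 < r <= 1 ->
  ~ (hausdorff 1 (eball 0 r `&` stripes) < +oo)%E.
Proof.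
move=> /andP[r0 r1] fin; set E := eball 0 r `&` stripes in fin.
have H0 := hausdorff_ge0 1 E.
case E1 : (hausdorff 1 E) fin H0 => [h| |] // _; rewrite lee_fin => h0.
pose a := r / 4; have a0 : 0 < a by rewrite divr_gt0.
have [k kP] := @half_expr_small R 1 a ler01 a0; rewrite mulr1 in kP.
pose p (t : R) := pt (a * (1 + (t - (Num.truncn t)%:R))) (height (k + Num.truncn t)).
pose N := (Num.truncn (2 / a * h)).+1.
have hN : 2 / a * h < N%:R by exact: truncnS_gt.
have flr (t : R) : 0 <= t -> 0 <= t - (Num.truncn t)%:R < 1.
  by move=> /truncn_itv; rewrite -natr1; lra.
have sub : `[0, N%:R]%classic `<=` `[0, N%:R]%classic `&` p @^-1` E.
  move=> t tN; split => //; move: tN; rewrite /= in_itv/= => /andP[t0 tN].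
  have := flr t t0; set f := t - _ => f01.
  have x0 : 0 <= a * (1 + f) by apply: mulr_ge0; lra.
  have xr : a * (1 + f) < 2 * a by nra.
  have kl : (1 / 2 : R) ^+ (k + Num.truncn t) <= a.
    apply: le_trans kP; rewrite exprD ler_piMr ?exprn_ge0// exprn_ile1//; lra.
  have hl : height (k + Num.truncn t) <= a.
    apply: le_trans kl; rewrite /height lerXn2r ?nnegrE//; lra.
  split; last first.
    exists (k + Num.truncn t)%N, (a * (1 + f)); split => //; apply/andP; split.
      by apply: le_trans kl _; nra.
    by rewrite /a in xr *; lra.
  rewrite /eball/= subr0; apply: le_lt_trans (enorm_pt_le _ _) _.
  have h1 := height_gt0 (k + Num.truncn t); rewrite -/f.
  rewrite !ger0_norm ?(ltW h1)//; move: hl xr; rewrite /a; lra.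
(* below this distance two parametrised points lie on the same stripe *)
have sep s t : `[0, N%:R]%classic s -> `[0, N%:R]%classic t ->
    enorm (p s - p t) <= height (k + N) / 4 -> `|s - t| <= a^-1 * enorm (p s - p t) `^ 1.
  rewrite /= !in_itv/= => /andP[s0 sN] /andP[t0 tN] d.
  rewrite powRr1 ?enorm_ge0// ler_pdivlMl//.
  move: d; rewrite /p ptB => d; have [d1 d2] := enorm_pt_ge (a * (1 + (s - (Num.truncn s)%:R)) -
     a * (1 + (t - (Num.truncn t)%:R))) (height (k + Num.truncn s) - height (k + Num.truncn t)).
  have kN : height (k + N) <= height (k + Num.truncn s).
    apply: ler_wiXn2l; [lra|lra|].
    by rewrite leq_add2l -(ler_nat R); case/andP: (truncn_itv s0) => [+ _]; move: sN; lra.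
  have hs := height_gt0 (k + Num.truncn s).
  have /height_sep/addnI st : `|height (k + Num.truncn s) - height (k + Num.truncn t)| <
     height (k + Num.truncn s) / 2 by lra.
  apply: le_trans d1; rewrite st -mulrBr normrM (gtr0_norm a0).
  by rewrite (_ : _ - (1 + _) = s - t) ?lexx//; ring.
have := @mass_distribution R 2 p `[0, N%:R]%classic 1 (height (k + N) / 4) a^-1 E ler01.
rewrite invr_gt0 => /(_ a0 sep) M.
have : (N%:R%:E <= (2 * a^-1)%:E * h%:E :> \bar R)%E.
  rewrite -[N%:R]subr0 -(@leb_itv R 0 N%:R)//; apply: le_trans (leb_le sub) _.
  apply: le_trans M _; apply: lee_wpmul2l; first by rewrite lee_fin mulr_ge0// invr_ge0 ltW.
  by rewrite -E1; apply: hausdorff_pre_le_hausdorff; rewrite divr_gt0// height_gt0.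
by rewrite -EFinM lee_fin; apply/negP; rewrite -ltNge.
Qed.

Lemma stripes_ebounded : ebounded stripes.
Proof.
exists 2 => _ [k [x [/andP[kx x1] ->]]]; apply: le_trans (enorm_pt_le _ _) _.
have x0 : 0 < x by apply: lt_le_trans kx; rewrite exprn_gt0.
have h0 := height_gt0 k; have : height k <= 1 by rewrite exprn_ile1//; lra.
by rewrite !gtr0_norm//; lra.
Qed.

Lemma stripes_not_strongly (A : set 'rV[R]_2) : stripes `<=` A ->
  ~ strongly_locally_finite R 2 1 A.
Proof.
move=> sA H; have [K cK AK] := ebounded_compact stripes_ebounded.
apply: (@stripes_infinite 1); first by rewrite ltr01 lexx.
apply: le_lt_trans (H K cK); apply: hausdorff_le => z [_ Az].
by split; [exact: AK|exact: sA].
Qed.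

Lemma stripes0_not_weakly : ~ weakly_locally_finite R 2 1 (0 |` stripes).
Proof.
move=> H; have [|r r0 rfin] := H 0; first by left.
apply: (@stripes_infinite (Num.min r 1)).
  by rewrite lt_min r0 ltr01/= ge_min lexx orbT.
apply: le_lt_trans rfin; apply: hausdorff_le => z [zr Az].
split; last by right.
by move: zr; rewrite /eball/= lt_min => /andP[].
Qed.

End Stripes.

(** * Complex multiplication and nested limits in the plane *)

Section PlaneCurves.
Variable R : realType.
Implicit Types v w : 'rV[R]_2.

(** Multiplication by the complex number c.1 + i c.2. *)
Definition cmul (c : R * R) v : 'rV[R]_2 :=
  pt (c.1 * v 0 0 - c.2 * v 0 1) (c.1 * v 0 1 + c.2 * v 0 0).

Lemma pt_inj v w : v 0 0 = w 0 0 -> v 0 1 = w 0 1 -> v = w.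
Proof.
move=> h0 h1; apply/rowP => i; case: (unliftP 0 i) => [k ->|-> //].
by rewrite (_ : lift 0 k = 1)//; apply: val_inj; rewrite /= ord1.
Qed.

Lemma cmulBl c c' v : cmul c v - cmul c' v = cmul (c.1 - c'.1, c.2 - c'.2) v.
Proof. by apply: pt_inj; rewrite !mxE/=; ring. Qed.

Lemma cmulBr c v w : cmul c v - cmul c w = cmul c (v - w).
Proof. by apply: pt_inj; rewrite !mxE/=; ring. Qed.

Lemma enorm_cmul_sqr c v : enorm (cmul c v) ^+ 2 = (c.1 ^+ 2 + c.2 ^+ 2) * enorm v ^+ 2.
Proof. by rewrite !enorm_sqr !dot2 !mxE/=; ring. Qed.

Lemma enorm_cmul c v : enorm (cmul c v) <= (`|c.1| + `|c.2|) * enorm v.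
Proof.
rewrite -ler_sqr ?nnegrE ?mulr_ge0 ?addr_ge0 ?enorm_ge0// enorm_cmul_sqr exprMn.
rewrite ler_wpM2r ?sqr_ge0// sqrrD !real_normK ?num_real//.
by have := mulr_ge0 (normr_ge0 c.1) (normr_ge0 c.2); lra.
Qed.

Lemma enorm_cmul_eq c v r : 0 <= r -> c.1 ^+ 2 + c.2 ^+ 2 = r ^+ 2 ->
  enorm (cmul c v) = r * enorm v.
Proof.
move=> r0 cr; apply/eqP; rewrite -(@eqrXn2 _ 2) ?mulr_ge0 ?enorm_ge0//.
by rewrite enorm_cmul_sqr cr exprMn.
Qed.

(** The intervals of radius b m around u m are nested. *)
Lemma nested_limit (u b : nat -> R) : (forall m, 0 <= b m) ->
  (forall m, `|u m.+1 - u m| + b m.+1 <= b m) -> exists x, forall m, `|x - u m| <= b m.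
Proof.
move=> b0 H.
have up m k : u m - b m <= u (m + k)%N - b (m + k)%N.
  elim: k => [|k IH]; first by rewrite addn0.
  by apply: le_trans IH _; rewrite addnS; have := H (m + k)%N; have := ler_norm (u (m + k)%N - u (m + k).+1); rewrite distrC; lra.
have dn m k : u (m + k)%N + b (m + k)%N <= u m + b m.
  elim: k => [|k IH]; first by rewrite addn0.
  by apply: le_trans _ IH; rewrite addnS; have := H (m + k)%N; have := ler_norm (u (m + k).+1 - u (m + k)%N); lra.
have cross m k : u m - b m <= u k + b k.
  apply: le_trans (up m k) _; apply: le_trans _ (dn k m); rewrite addnC.
  by have := b0 (k + m)%N; lra.
pose S := [set u m - b m | m in [set: nat]].
have S0 : S !=set0 by exists (u 0%N - b 0%N), 0%N.
have Sub k : ubound S (u k + b k) by move=> _ [m _ <-]; exact: cross.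
exists (sup S) => m; have h1 : sup S <= u m + b m by apply: ge_sup.
have h2 : u m - b m <= sup S by apply: ub_le_sup; [exists (u 0%N + b 0%N); exact: Sub|exists m].
by rewrite ler_norml; lra.
Qed.

End PlaneCurves.

(** * The Koch curve with variable tilts *)

Section Snowflake.
Variables (R : realType) (tau : nat -> R).
Hypothesis tau_gt0 : forall k, 0 < tau k.
Hypothesis tau_noninc : forall k l, (k <= l)%N -> tau l <= tau k.
Hypothesis tau_small : tau 0 <= 1 / 1024.

(** The four edges of the generator, as multiples of the parent edge: with
    u = 1 + i x and u' = 1 - i x they are u u' / 4, u u / 4, u' u' / 4, u u' / 4.
    They add up to 1 and have equal modulus (1 + x^2) / 4.  The two outer ones
    are parallel to the parent, so that corners keep their angle under
    subdivision.  Digits are reduced modulo 4, the default case being 0 and 3. *)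
Definition coef (x : R) (d : nat) : R * R :=
  match d with
  | 1 => ((1 - x ^+ 2) / 4, x / 2)
  | 2 => ((1 - x ^+ 2) / 4, - (x / 2))
  | _ => ((1 + x ^+ 2) / 4, 0)
  end.

(** The partial sums of [coef]. *)
Definition psum (x : R) (d : nat) : R * R :=
  match d with
  | 0 => (0, 0)
  | 1 => ((1 + x ^+ 2) / 4, 0)
  | 2 => (1 / 2, x / 2)
  | _ => ((3 - x ^+ 2) / 4, 0)
  end.

(** Edges and vertices of the polygon of level m are indexed by all natural
    numbers: beyond 4^m the polygon continues with translated copies, which spares
    boundary conditions. *)
Fixpoint edge (m p : nat) : 'rV[R]_2 :=
  if m is m'.+1 then cmul (coef (tau m') (p %% 4)) (edge m' (p %/ 4)) else pt 1 0.

Fixpoint vert (m p : nat) : 'rV[R]_2 :=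
  if m is m'.+1 then vert m' (p %/ 4) + cmul (psum (tau m') (p %% 4)) (edge m' (p %/ 4))
  else pt p%:R 0.

(** The common length of the edges of level m. *)
Definition elen (m : nat) : R := \prod_(k < m) ((1 + tau k ^+ 2) / 4).

Lemma elenS m : elen m.+1 = elen m * ((1 + tau m ^+ 2) / 4).
Proof. by rewrite /elen big_ord_recr. Qed.

Lemma tau_bnd k : 0 < tau k <= 1 / 1024.
Proof. by rewrite tau_gt0 (le_trans _ tau_small)// tau_noninc. Qed.

Lemma elen_gt0 m : 0 < elen m.
Proof. by apply: prodr_gt0 => i _; rewrite divr_gt0// ltr_wpDr// sqr_ge0. Qed.

Lemma elen_half m : elen m.+1 <= elen m / 2.
Proof.
have := tau_bnd m; have := elen_gt0 m; rewrite elenS => r0 t0.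
by rewrite ler_pM2l//; nra.
Qed.

Lemma elen_noninc k l : (k <= l)%N -> elen l <= elen k.
Proof.
move=> /subnKC <-; elim: (l - k)%N => [|i IH]; first by rewrite addn0.
apply: le_trans IH; rewrite addnS; have := elen_half (k + i); have := elen_gt0 (k + i).
by lra.
Qed.

Lemma enorm_edge m p : enorm (edge m p) = elen m.
Proof.
elim: m p => [|m IH] p /=; first by rewrite enorm_pt0 normr1 /elen big_ord0.
rewrite elenS -(IH (p %/ 4)%N) mulrC; apply: enorm_cmul_eq.
  by rewrite divr_ge0// addr_ge0// sqr_ge0.
have : (p %% 4 < 4)%N by rewrite ltn_pmod.
by case: (p %% 4)%N => [|[|[|[|]]]]//= _; field.
Qed.

Lemma div4P p : exists q d, [/\ p = (q * 4 + d)%N, (d < 4)%N, (p %/ 4 = q)%N & (p %% 4 = d)%N].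
Proof. by exists (p %/ 4)%N, (p %% 4)%N; rewrite ltn_pmod// -divn_eq. Qed.

Lemma divS q d : (d < 4)%N -> ((q * 4 + d) %/ 4 = q)%N /\ ((q * 4 + d) %% 4 = d)%N.
Proof. by move=> d4; rewrite divnMDl// divn_small// addn0 modnMDl modn_small. Qed.

Lemma vertS m p : vert m p.+1 - vert m p = edge m p.
Proof.
elim: m p => [|m IH] p /=; first by rewrite ptB subrr -natr1 addrAC subrr add0r.
have [q [d [-> d4 -> ->]]] := div4P p.
case: d d4 => [|[|[|[|//]]]] _; last first.
  rewrite -[X in (X %/ 4)%N]addnS -[X in (X %% 4)%N]addnS (_ : (q * 4 + 4)%N = (q.+1 * 4 + 0)%N); last first.
    by rewrite mulSn addn0 addnC.
  have [-> ->] := @divS q.+1 0 isT; rewrite -(IH q) [coef _ _]/= [psum _ 3]/= [psum _ 0]/=.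
  by move: (vert m q.+1) (vert m q) (edge m _) => V W E; apply: pt_inj; rewrite !mxE/=; field.
all: rewrite -addnS; match goal with |- context [(_ + ?d.+1)%N] => have [-> ->] := @divS q d.+1 isT end.
all: rewrite opprD addrACA subrr add0r cmulBl; congr cmul; congr pair; rewrite /=; by field.
Qed.

(** The vertex p + 1, shared by the edges p and p + 1 of level m, was present at
    level k exactly when 4^(m - k) divides p + 1.  Consecutive edges make an
    angle that was created with their common vertex and is kept afterwards;
    hence if that vertex is younger than level k the angle is governed by tau_k,
    the tilts being nonincreasing.  The vertices of level 0 are straight, whence
    no condition for k = 0. *)
Lemma edge_adj k m p : (k <= m)%N -> k = 0%N \/ ~~ (4 ^ (m - k) %| p.+1)%N ->
  enorm (edge m p.+1 - edge m p) <= 4 * tau k * elen m.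
Proof.
elim: m p => [|m IH] p.
  by rewrite leqn0 => /eqP -> _; rewrite subrr enorm0 !mulr_ge0 ?(ltW (tau_gt0 _)) ?(ltW (elen_gt0 _)).
move=> km kp; have := tau_gt0 k; have := tau_bnd m; have := elen_gt0 m => r0 tm tk.
have [q [d [pE d4 dq dm]]] := div4P p; rewrite /= dq dm elenS.
have inner c c' : k != m.+1 -> `|c.1 - c'.1| + `|c.2 - c'.2| <= tau m ->
   enorm (cmul c (edge m q) - cmul c' (edge m q)) <= 4 * tau k * (elen m * ((1 + tau m ^+ 2) / 4)).
  move=> kSm cc; rewrite cmulBl; apply: le_trans (enorm_cmul _ _) _ => /=.
  rewrite enorm_edge; have kt : tau m <= tau k by apply: tau_noninc; rewrite -ltnS ltn_neqAle kSm.
  have -> : 4 * tau k * (elen m * ((1 + tau m ^+ 2) / 4)) = tau k * (1 + tau m ^+ 2) * elen m by field.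
  rewrite ler_pM2r//; apply: le_trans cc _; apply: le_trans kt _.
  by rewrite ler_peMr ?(ltW tk)// lerDl sqr_ge0.
have kSm : k != m.+1 by apply/eqP => kE; case: kp => [k0|]; [rewrite k0 in kE|rewrite kE subnn expn0 dvd1n].
case: d d4 pE dm => [|[|[|[|//]]]] _ pE dm; last first.
  have pS : p.+1 = (q.+1 * 4)%N by rewrite pE mulSn addnC addSn.
  rewrite pS modnMl mulnK// cmulBr (@enorm_cmul_eq _ _ _ ((1 + tau m ^+ 2) / 4)); last 2 first.
  - by rewrite divr_ge0// addr_ge0// sqr_ge0.
  - by rewrite /= expr0n addr0.
  rewrite mulrC mulrA ler_pM2r ?divr_gt0 ?ltr_wpDr ?sqr_ge0//; apply: IH.
    by rewrite -ltnS ltn_neqAle kSm.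
  case: kp => [|kp]; [by left|right]; apply: contra kp => h.
  by rewrite pS subSn ?expnSr ?dvdn_pmul2r// -ltnS ltn_neqAle kSm.
all: rewrite pE -addnS; match goal with |- context [(_ + ?d.+1)%N] => have [-> ->] := @divS q d.+1 isT end.
all: apply: inner => //=.
- rewrite [X in `|X| + _](_ : _ = tau m ^+ 2 / 2); last by field.
  by rewrite sub0r opprK !ger0_norm; nra.
- rewrite [X in `|X| + _](_ : _ = 0); last by field.
  rewrite [X in _ + `|X|](_ : _ = - tau m); last by field.
  by rewrite normr0 add0r normrN ger0_norm; lra.
- rewrite subr0 [X in `|X| + _](_ : _ = - (tau m ^+ 2 / 2)); last by field.
  by rewrite normrN !ger0_norm; nra.
Qed.


Definition scale (m : nat) (t : R) : R := 4 ^+ m * t.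
Definition idx (m : nat) (t : R) : nat := Num.truncn (scale m t).

Lemma idxP m t : 0 <= t -> (idx m t)%:R <= scale m t < (idx m t)%:R + 1.
Proof.
by move=> t0; rewrite natr1; apply: truncn_itv; rewrite mulr_ge0 ?exprn_ge0.
Qed.

(** The polygon of level m, parametrised with constant speed on [0, +oo[. *)
Definition poly_curve (m : nat) (t : R) : 'rV[R]_2 :=
  vert m (idx m t) + (scale m t - (idx m t)%:R) *: edge m (idx m t).

(** Both polygons agree at the vertices of level m; in between, the generator
    stays within 2 tau_m times the edge length. *)
Lemma poly_step m t : 0 <= t ->
  enorm (poly_curve m.+1 t - poly_curve m t) <= 2 * tau m * elen m.
Proof.
move=> t0; rewrite /poly_curve /=.
have [q [d [qE d4 dq dm]]] := div4P (idx m.+1 t); rewrite dq dm.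
have /andP[u1 u2] := idxP m t0; have /andP[v1 v2] := idxP m.+1 t0.
have uv : scale m.+1 t = 4 * scale m t by rewrite /scale exprS mulrA.
rewrite uv in v1 v2 *; move: v1 v2; rewrite qE natrD natrM => v1 v2.
have qp : q = idx m t.
  have dR : d%:R <= 3%:R :> R by rewrite ler_nat.
  have d0 : 0 <= d%:R :> R by [].
  have qu : (q < (idx m t).+1)%N by rewrite -(ltr_nat R) -natr1; lra.
  have uq : (idx m t < q.+1)%N by rewrite -(ltr_nat R) -natr1; lra.
  by apply/eqP; rewrite eqn_leq; apply/andP; split; rewrite -ltnS.
rewrite -qp in u1 u2 *; set e := edge m q.
set phi := 4 * scale m t - (q%:R * 4 + d%:R).
have phi01 : 0 <= phi < 1 by rewrite /phi; apply/andP; split; lra.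
have uE : scale m t - q%:R = (d%:R + phi) / 4 by rewrite /phi; field.
rewrite uE.
set A := (psum (tau m) d).1 + phi * (coef (tau m) d).1 - (d%:R + phi) / 4.
set B := (psum (tau m) d).2 + phi * (coef (tau m) d).2.
rewrite (_ : _ - _ = cmul (A, B) e); last first.
  by rewrite /A /B; apply: pt_inj; rewrite !mxE/=; ring.
apply: le_trans (enorm_cmul _ _) _ => /=; rewrite enorm_edge.
rewrite ler_pM2r ?elen_gt0//; have tm := tau_bnd m.
have [t1 t2] : tau m ^+ 2 <= tau m /\ 0 <= tau m ^+ 2 by split; nra.
rewrite /A /B; case: d d4 {dm v1 v2 qE uE A B} @phi phi01 => [|[|[|[|//]]]] _ phi phi01 /=.
- rewrite [X in `|X| + _](_ : _ = phi * tau m ^+ 2 / 4); last by field.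
  by rewrite mulr0 addr0 normr0 addr0 ger0_norm; nra.
- rewrite [X in `|X| + _](_ : _ = (1 - phi) * tau m ^+ 2 / 4); last by field.
  by rewrite add0r !ger0_norm; nra.
- rewrite [X in `|X| + _](_ : _ = - (phi * tau m ^+ 2 / 4)); last by field.
  rewrite [X in _ + `|X|](_ : _ = (1 - phi) * tau m / 2); last by field.
  by rewrite normrN !ger0_norm; nra.
- rewrite [X in `|X| + _](_ : _ = - ((1 - phi) * tau m ^+ 2 / 4)); last by field.
  by rewrite mulr0 addr0 normr0 addr0 normrN ger0_norm; nra.
Qed.

Lemma curve_exists t : exists x : 'rV[R]_2, 0 <= t -> forall m,
  enorm (x - poly_curve m t) <= 8 * tau m * elen m.
Proof.
have [t0|t0] := boolP (0 <= t); last by exists 0.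
have /choice[x xP] : forall i : 'I_2, exists x : R, forall m,
    `|x - poly_curve m t 0 i| <= 4 * tau m * elen m.
  move=> i; apply: nested_limit => m.
    by rewrite !mulr_ge0 ?(ltW (tau_gt0 _)) ?(ltW (elen_gt0 _)).
  have := poly_step m t0; have := enorm_coord (poly_curve m.+1 t - poly_curve m t) i.
  rewrite !mxE => h1 h2; have h3 := tau_noninc (leqnSn m); have h4 := elen_half m.
  have : tau m.+1 * elen m.+1 <= tau m * (elen m / 2).
    by apply: ler_pM; rewrite ?(ltW (tau_gt0 _)) ?(ltW (elen_gt0 _)).
  by lra.
exists (\row_i x i) => _ m.
have -> : 8 * tau m * elen m = 2%:R * (4 * tau m * elen m) by ring.
apply: enorm_le_coords => i.
have -> : (\row_i x i - poly_curve m t) 0 i = x i - poly_curve m t 0 i by rewrite !mxE.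
exact: xP.
Qed.

(** The limit curve, chosen by its distance to all the polygons. *)
Definition curve (t : R) : 'rV[R]_2 := sval (cid (curve_exists t)).

Lemma curveP t m : 0 <= t -> enorm (curve t - poly_curve m t) <= 8 * tau m * elen m.
Proof. by move=> t0; exact: (svalP (cid (curve_exists t)) t0 m). Qed.

Lemma edge_lin m p l kappa :
  (forall i, (p <= i < p + l)%N -> enorm (edge m i.+1 - edge m i) <= kappa) ->
  enorm (edge m (p + l) - edge m p) <= l%:R * kappa.
Proof.
elim: l => [|l IH] H; first by rewrite addn0 subrr enorm0 mul0r.
rewrite addnS; apply: le_trans (enorm_triangle (edge m (p + l)) _ _) _.
rewrite -natr1 mulrDl mul1r addrC lerD//.
  by apply: IH => i /andP[pi il]; apply: H; rewrite pi addnS ltnS ltnW.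
by apply: H; rewrite leq_addr addnS ltnS leqnn.
Qed.

Lemma vert_lin m p l kappa : 0 <= kappa ->
  (forall i, (p <= i < p + l)%N -> enorm (edge m i.+1 - edge m i) <= kappa) ->
  enorm (vert m (p + l) - vert m p - l%:R *: edge m p) <= l%:R ^+ 2 * kappa.
Proof.
move=> k0; elim: l => [|l IH] H.
  by rewrite addn0 subrr scale0r subrr enorm0 mulr_ge0 ?sqr_ge0.
have H' i : (p <= i < p + l)%N -> enorm (edge m i.+1 - edge m i) <= kappa.
  by move=> /andP[pi il]; apply: H; rewrite pi addnS ltnS ltnW.
rewrite (_ : _ - _ = (vert m (p + l) - vert m p - l%:R *: edge m p) +
    (edge m (p + l) - edge m p)); last first.
  by rewrite addnS -[edge m (p + l)]vertS -natr1; apply/rowP => i; rewrite !mxE; ring.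
apply: le_trans (enormD _ _) _; have h1 := IH H'; have h2 := edge_lin H'.
apply: le_trans (lerD h1 h2) _; rewrite -mulrDl; apply: ler_wpM2r => //.
by rewrite -natr1; have : 0 <= l%:R :> R by []; nra.
Qed.

(** If consecutive edges between the parameters t and s differ by at most kappa,
    all of the at most six edges involved differ by at most 5 kappa.  Both
    increments of the polygon, from t and from s, are thus nearly multiples of
    the edge at their base point. *)
Lemma poly_lin m s t kappa : 0 <= t <= s -> scale m s - scale m t <= 4 -> 0 <= kappa ->
  (forall i, (idx m t <= i < idx m s)%N -> enorm (edge m i.+1 - edge m i) <= kappa) ->
  enorm (poly_curve m s - poly_curve m t - (scale m s - scale m t) *: edge m (idx m t))
    <= 30 * kappa /\
  enorm (poly_curve m t - poly_curve m s - (scale m t - scale m s) *: edge m (idx m s))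
    <= 50 * kappa.
Proof.
move=> /andP[t0 ts] st4 k0 H; have s0 := le_trans t0 ts.
have /andP[u1 u2] := idxP m t0; have /andP[v1 v2] := idxP m s0.
have st : scale m t <= scale m s by rewrite ler_wpM2l ?exprn_ge0.
have pq : (idx m t <= idx m s)%N.
  by rewrite -ltnS -(ltr_nat R) -natr1; lra.
have [l lE] : exists l, idx m s = (idx m t + l)%N by exists (idx m s - idx m t)%N; rewrite subnKC.
have l5 : l%:R <= 5 :> R.
  have : (l%:R : R) < 5.+1%:R by move: v1; rewrite lE natrD; lra.
  by rewrite ltr_nat ltnS -(ler_nat R).
rewrite /poly_curve; rewrite lE in H v1 v2 *; move: v1 v2; rewrite natrD => v1 v2.
set p := idx m t in H u1 u2 v1 v2 *.
have hv := vert_lin k0 H; have he := edge_lin H.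
have l0 : 0 <= l%:R :> R by [].
have hv' : enorm (vert m (p + l) - vert m p - l%:R *: edge m p) <= 25 * kappa.
  by apply: le_trans hv _; apply: ler_wpM2r => //; nra.
have he' : enorm (edge m (p + l) - edge m p) <= 5 * kappa.
  by apply: le_trans he _; exact: ler_wpM2r.
set E := edge m (p + l) in he' *; set E0 := edge m p in hv' he' *.
set V := vert m (p + l) in hv' *; set V0 := vert m p in hv' *.
have main : enorm (V + (scale m s - (p%:R + l%:R)) *: E - (V0 + (scale m t - p%:R) *: E0) -
   (scale m s - scale m t) *: E0) <= 30 * kappa.
  rewrite (_ : _ - _ = (V - V0 - l%:R *: E0) + (scale m s - (p%:R + l%:R)) *: (E - E0)); last first.
    by apply/rowP => i; rewrite !mxE; ring.
  apply: le_trans (enormD _ _) _; rewrite enormZ.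
  have : `|scale m s - (p%:R + l%:R)| * enorm (E - E0) <= 1 * (5 * kappa).
    apply: ler_pM; rewrite ?normr_ge0 ?enorm_ge0//.
    by rewrite ger0_norm; lra.
  by lra.
split => //; rewrite (_ : _ - _ = - (V + (scale m s - (p%:R + l%:R)) *: E -
    (V0 + (scale m t - p%:R) *: E0) - (scale m s - scale m t) *: E0) +
    (scale m s - scale m t) *: (E - E0)); last first.
  by apply/rowP => i; rewrite !mxE; ring.
apply: le_trans (enormD _ _) _; rewrite enormN enormZ.
have : `|scale m s - scale m t| * enorm (E - E0) <= 4 * (5 * kappa).
  apply: ler_pM; rewrite ?normr_ge0 ?enorm_ge0//.
  by rewrite ger0_norm; lra.
by lra.
Qed.

(** The parameters that stay away from the vertices c / 4^k of each level k, by a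
    distance that is summably small after counting vertices. *)
Definition junction_free : set R := [set t | 0 <= t <= 1 /\
  forall k c : nat, (1 / 4) ^+ (2 * k + 2) <= `|t - c%:R / 4 ^+ k|].

(** A vertex of level at most k is invisible at level m: it is at distance at
    least 4^(-2k-2) from the admissible parameters, more than the window 4 / 4^m.
    For k = 0 no condition is imposed, since [edge_adj] imposes none. *)
Definition fine_level (k m : nat) := k = 0%N \/ (2 * k + 4 <= m)%N.

Lemma fine_level_subn k m : (2 * k + 4 <= m)%N ->
  [/\ (k <= m)%N, (2 * k + 2 <= m)%N & (m - (2 * k + 2) = (m - (2 * k + 4)).+2)%N].
Proof. by move=> h; split; lia. Qed.

Lemma fine_level_le k m : fine_level k m -> (k <= m)%N.
Proof. by case=> [->//|/fine_level_subn[]]. Qed.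

(** A vertex of level k between t and s would be closer to t than
    [junction_free] allows. *)
Lemma junction_free_adj k m s t i : junction_free t -> 0 <= t <= s -> scale m s - scale m t <= 4 ->
  fine_level k m -> (idx m t <= i < idx m s)%N ->
  enorm (edge m i.+1 - edge m i) <= 4 * tau k * elen m.
Proof.
move=> [_ gt] /andP[t0 ts] st4 fk /andP[ti is_].
have km := fine_level_le fk.
apply: edge_adj => //; case: fk => [->|fk]; [by left|right].
have [_ km2 kmE] := fine_level_subn fk; apply/negP => /dvdnP[c cE].
have s0 := le_trans t0 ts.
have /andP[u1 u2] := idxP m t0; have /andP[v1 v2] := idxP m s0.
have h1 : (idx m t)%:R <= i%:R :> R by rewrite ler_nat.
have h2 : i%:R + 1 <= (idx m s)%:R :> R by rewrite natr1 ler_nat.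
have cR : i%:R + 1 = c%:R * 4 ^+ (m - k) :> R by rewrite natr1 cE natrM natrX.
have := gt k c; rewrite leNgt => /negP; apply.
have p4 a : 0 < (4 : R) ^+ a by rewrite exprn_gt0.
have -> : t - c%:R / 4 ^+ k = (scale m t - (i%:R + 1)) / 4 ^+ m.
  rewrite cR /scale mulrBl mulrAC divff ?gt_eqF// mul1r; congr (_ - _).
  have -> : 4 ^+ m = 4 ^+ (m - k) * 4 ^+ k :> R by rewrite -exprD subnK.
  by field; rewrite !gt_eqF.
rewrite normrM [X in _ * X]gtr0_norm ?invr_gt0//.
have -> : (1 / 4 : R) ^+ (2 * k + 2) = 4 ^+ (m - (2 * k + 2)) / 4 ^+ m.
  have -> : 4 ^+ m = 4 ^+ (m - (2 * k + 2)) * 4 ^+ (2 * k + 2) :> R.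
    by rewrite -exprD subnK.
  by rewrite expr_div_n expr1n; field; rewrite !gt_eqF.
rewrite ltr_pM2r ?invr_gt0//; apply: (@le_lt_trans _ _ 4).
  by rewrite ler_norml; lra.
rewrite kmE !exprS mulrA; have : 1 <= (4 : R) ^+ (m - (2 * k + 4)) by rewrite exprn_ege1// ler1n.
by lra.
Qed.

(** Two limits cost 16 tau_m and the polygon at most 200 tau_k edge lengths. *)
Lemma curve_est k m s t : junction_free s -> junction_free t -> `|s - t| <= 4 * (1 / 4) ^+ m -> fine_level k m ->
  enorm (curve s - curve t - (scale m s - scale m t) *: edge m (idx m t)) <=
  256 * tau k * elen m.
Proof.
move=> gs gt st fk; have [[/andP[s0 _] _] [/andP[t0 _] _]] := (gs, gt).
have km := fine_level_le fk.
have p4 : 0 < (4 : R) ^+ m by rewrite exprn_gt0.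
have st4 : `|scale m s - scale m t| <= 4.
  rewrite -mulrBr normrM gtr0_norm// mulrC -ler_pdivlMr//.
  by apply: le_trans st _; rewrite expr_div_n expr1n mul1r.
have k0 : 0 <= 4 * tau k * elen m.
  by rewrite !mulr_ge0 ?(ltW (tau_gt0 _)) ?(ltW (elen_gt0 _)).
have key : enorm (poly_curve m s - poly_curve m t - (scale m s - scale m t) *: edge m (idx m t))
    <= 50 * (4 * tau k * elen m).
  have [ts|/ltW ts] := leP t s.
    have d4 : scale m s - scale m t <= 4 by move: st4; rewrite ler_norml => /andP[].
    have t0s : 0 <= t <= s by rewrite t0.
    have [h _] := @poly_lin m s t _ t0s d4 k0 (fun i => junction_free_adj gt t0s d4 fk).
    by apply: le_trans h _; rewrite ler_wpM2r// ler_nat.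
  have d4 : scale m t - scale m s <= 4 by move: st4; rewrite distrC ler_norml => /andP[].
  have s0t : 0 <= s <= t by rewrite s0.
  by have [_ h] := @poly_lin m t s _ s0t d4 k0 (fun i => junction_free_adj gs s0t d4 fk).
have cs := curveP m s0; have ct := curveP m t0.
have tk : tau m * elen m <= tau k * elen m by rewrite ler_pM2r ?elen_gt0// tau_noninc.
rewrite (_ : _ - _ = (curve s - poly_curve m s) + ((poly_curve m s - poly_curve m t -
   (scale m s - scale m t) *: edge m (idx m t)) - (curve t - poly_curve m t))); last first.
  by apply/rowP => i; rewrite !mxE; ring.
apply: le_trans (enormD _ _) _.
have := enormD (poly_curve m s - poly_curve m t - (scale m s - scale m t) *: edge m (idx m t))
  (- (curve t - poly_curve m t)); rewrite enormN.
by move: cs ct key tk; lra.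
Qed.

(** Parameters at distance at least 4^-m move along the polygon by at least one
    edge length, and the tilts are too small to undo more than half of that. *)
Lemma curve_lower m s t : junction_free s -> junction_free t ->
  (1 / 4) ^+ m <= `|s - t| <= 4 * (1 / 4) ^+ m -> elen m <= 2 * enorm (curve s - curve t).
Proof.
move=> gs gt /andP[st1 st2].
have := @curve_est 0 m s t gs gt st2 (or_introl erefl).
have p4 : 0 < (4 : R) ^+ m by rewrite exprn_gt0.
have h1 : 1 <= `|scale m s - scale m t|.
  rewrite -mulrBr normrM gtr0_norm// mulrC -ler_pdivrMr//.
  by move: st1; rewrite expr_div_n expr1n.
have h2 : elen m <= enorm ((scale m s - scale m t) *: edge m (idx m t)).
  by rewrite enormZ enorm_edge ler_peMl// ltW// elen_gt0.
have := enorm_sub ((scale m s - scale m t) *: edge m (idx m t)) (curve s - curve t).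
rewrite [enorm (_ *: _ - _)]enormB => h3 h4.
have h5 : tau 0 * elen m <= 1 / 1024 * elen m by rewrite ler_pM2r ?elen_gt0.
have := elen_gt0 m; lra.
Qed.

Lemma quarter_level x : 0 < x <= 1 -> exists m, (1 / 4 : R) ^+ m <= x <= 4 * (1 / 4) ^+ m.
Proof.
move=> /andP[x0 x1].
have ex : exists m, (1 / 4 : R) ^+ m <= x.
  have [m mP] := @half_expr_small R 1 x ler01 x0; exists m; rewrite mulr1 in mP.
  by apply: le_trans mP; rewrite lerXn2r ?nnegrE; lra.
case: (ex_minnP ex) => -[|m] mx mmin; first by exists 0%N; rewrite mx expr0; lra.
exists m.+1; rewrite mx/= exprS mulrA; have : ~~ ((1 / 4 : R) ^+ m <= x).
  by apply/negP => /mmin; rewrite ltnn.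
by rewrite -ltNge => /ltW; lra.
Qed.

Lemma curve_level s t : junction_free s -> junction_free t -> s != t ->
  exists2 m, `|s - t| <= 4 * (1 / 4) ^+ m & elen m <= 2 * enorm (curve s - curve t).
Proof.
move=> gs gt st; have [m mP] : exists m, (1 / 4) ^+ m <= `|s - t| <= 4 * (1 / 4) ^+ m.
  apply: quarter_level; rewrite normr_gt0 subr_eq0 st /=.
  by move: gs gt => [/andP[? ?] _] [/andP[? ?] _]; rewrite ler_norml; lra.
by exists m; [case/andP: mP|exact: curve_lower].
Qed.

Definition snowflake : set 'rV[R]_2 := curve @` junction_free.

Lemma elen_small e : 0 < e -> exists m, elen m < e.
Proof.
move=> e0; have [m mP] := @half_expr_small R 1 (e / 2) ler01 (divr_gt0 e0 (ltr0n _ 2)).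
exists m; apply: (@le_lt_trans _ _ (e / 2)); last by lra.
apply: le_trans mP; rewrite mulr1; elim: m => [|m IH]; first by rewrite /elen big_ord0.
by apply: le_trans (elen_half m) _; rewrite exprS; lra.
Qed.

(** Let m be the first level with edges shorter than 2 rho.  Points of the curve
    at distance below rho come from parameters at distance at most 4 / 4^m, by
    [curve_lower] and the choice of m; [curve_est] then puts them near the line
    spanned by the edge of level m. *)
Lemma snowflake_flat k t rho gamma : junction_free t -> 0 < rho -> 512 * tau k <= gamma ->
  (forall m, elen m < 2 * rho -> fine_level k m) ->
  exists2 L, Gr R 2 1 L &
    eball (curve t) rho `&` snowflake `<=` nbhd_of (translate L (curve t)) (gamma * rho).
Proof.
move=> gt rho0 kg fk; have ex : exists m, elen m < 2 * rho by apply: elen_small; lra.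
case: (ex_minnP ex) => m mr mmin.
exists <[edge m (idx m t)]>%VS.
  by rewrite /Gr/= dim_vline; case: eqP => // e0; have := enorm_edge m (idx m t); rewrite e0 enorm0 => r0; have := elen_gt0 m; rewrite -r0 ltxx.
move=> z [zr [s gs sz]]; move: zr; rewrite -{z}sz /eball/= => sr; apply/nbhd_translate.
exists ((scale m s - scale m t) *: edge m (idx m t)); first exact/memvZ/memv_line.
have st : `|s - t| <= 4 * (1 / 4) ^+ m.
  have [->|st] := eqVneq s t; first by rewrite subrr normr0 mulr_ge0// exprn_ge0.
  have [l ll lr] := curve_level gs gt st; apply: le_trans ll _; rewrite ler_pM2l//.
  by apply: ler_wiXn2l; [lra|lra|]; apply: mmin; lra.
apply: le_lt_trans (curve_est gs gt st (fk m mr)) _.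
have h1 : tau k * elen m < tau k * (2 * rho) by rewrite ltr_pM2l// tau_gt0.
have h2 : 512 * tau k * rho <= gamma * rho by rewrite ler_pM2r.
by lra.
Qed.

Lemma snowflake_ball : snowflake `<=` eball 0 4.
Proof.
move=> _ [t [/andP[t0 t1] _] <-]; rewrite /eball/= subr0.
have h1 : enorm (poly_curve 0 t) <= 1.
  have -> : poly_curve 0 t = pt t 0.
    by apply: pt_inj; rewrite !mxE/= /scale expr0 mul1r; ring.
  by rewrite enorm_pt0 ger0_norm.
have h2 := curveP 0 t0; have := enorm_sub (curve t) (poly_curve 0 t).
by have := tau_small; move: h2; rewrite /elen big_ord0 mulr1; lra.
Qed.

Lemma snowflake_wrho0j gamma : 512 * tau 0 <= gamma -> wrho0j gamma 2 1 snowflake.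
Proof.
move=> tg; exists 4; split => //; first by exists 0; exact: snowflake_ball.
move=> _ [t gt <-] rho /andP[rho0 _].
by apply: (@snowflake_flat 0) => // m _; left.
Qed.

Lemma snowflake_wrhodeltaj : (forall e, 0 < e -> exists k, tau k <= e) ->
  wrhodeltaj R 2 1 snowflake.
Proof.
move=> tau0 gamma /andP[g0 g1] y _.
have [|k kg] := tau0 (gamma / 512); first by lra.
(* below this radius [snowflake_flat] works at levels m > 2 k + 4 *)
exists (elen (2 * k + 4) / 2); first by rewrite divr_gt0// elen_gt0.
move=> rho /andP[rho0 rhok] _ [_ [t gt <-]].
apply: (@snowflake_flat k) => //; first by lra.
move=> m mr; right; rewrite leqNgt; apply/negP => mk.
by have := elen_noninc (ltnW mk); lra.
Qed.

(** The length of the polygon of level m over [0, 1]. *)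
Definition growth m : R := 4 ^+ m * elen m.

Lemma growth_prod m : growth m = \prod_(k < m) (1 + tau k ^+ 2).
Proof.
rewrite /growth /elen -[m in 4 ^+ m]card_ord -prodr_const -big_split/=.
by apply: eq_bigr => k _; field.
Qed.

Lemma growth_nondec k l : (k <= l)%N -> growth k <= growth l.
Proof.
move=> /subnKC <-; elim: (l - k)%N => [|i IH]; first by rewrite addn0.
apply: le_trans IH _; rewrite addnS !growth_prod big_ord_recr/= ler_peMr//.
  by apply: prodr_ge0 => a _; rewrite addr_ge0// sqr_ge0.
by rewrite lerDl sqr_ge0.
Qed.

(** At level m a parameter distance of order 4^-m corresponds to a distance of
    order 4^-m times the growth. *)
Lemma curve_expanding : (forall B, exists m, B <= growth m) -> expanding curve junction_free.
Proof.
move=> G e e0; have [M MG] := G (8 / e).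
(* shorter distances come from levels at which the growth is at least 8 / e *)
exists (elen M / 3); first by rewrite divr_gt0// elen_gt0.
move=> s t gs gt d; have [->|st] := eqVneq s t.
  by rewrite !subrr normr0 enorm0 mulr0.
have [m m1 m2] := curve_level gs gt st.
have rM := elen_gt0 M; have rm := elen_gt0 m.
have Mm : (M <= m)%N.
  by rewrite leqNgt; apply/negP => /ltnW/elen_noninc; lra.
apply: le_trans m1 _.
have p4 : 0 < (4 : R) ^+ m by rewrite exprn_gt0.
have -> : 4 * (1 / 4) ^+ m = 4 * elen m / growth m :> R.
  by rewrite /growth expr_div_n expr1n; field; rewrite !gt_eqF.
have g8 : 8 / e <= growth m := le_trans MG (growth_nondec Mm).
have gm : 0 < growth m by rewrite mulr_gt0.
rewrite ler_pdivrMr//; set D := enorm _ in m2 *.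
have D0 : 0 <= D by exact: enorm_ge0.
have eg : 8 <= e * growth m by rewrite mulrC -ler_pdivrMr.
by rewrite mulrAC; nra.
Qed.

End Snowflake.

(** * Parameters far from the corners; constant tilt *)

Section FullMeasure.
Variable R : realType.

Lemma leb_fin (n : nat) (X : nat -> set R) (w : R) : 0 <= w ->
  (forall i, (i < n)%N -> (leb (X i) <= w%:E)%E) ->
  (leb (\bigcup_(i in `I_n) X i) <= (n%:R * w)%:E)%E.
Proof.
move=> w0; elim: n => [|n IH] H; first by rewrite II0 bigcup_set0 /leb measure0 mul0r.
rewrite IIS bigcup_setU bigcup_set1; apply: (@le_trans _ _ (leb (\bigcup_(i in `I_n) X i) + leb (X n))%E).
  pose Y (i : nat) := if i is 0 then \bigcup_(i in `I_n) X i else if i is 1 then X n else set0.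
  apply: (@le_trans _ _ (leb (\bigcup_i Y i))).
    by apply: leb_le => t [Xt|Xt]; [exists 0%N|exists 1%N].
  apply: le_trans (leb_bigcup _) _.
  rewrite (@nneseries_split _ _ 0 2); last by move=> *; exact: leb_ge0.
  rewrite eseries0 ?adde0; last by move=> [|[|i]]// _ _; rewrite /leb measure0.
  by rewrite !big_nat_recr//= big_geq// add0e.
rewrite -natr1 mulrDl mul1r EFinD; apply: leeD; last exact: H.
by apply: IH => i ni; apply: H; exact: ltnW.
Qed.

(** At level k the removed intervals have total length
    (4^k + 1) 2 / 4^(2k+2) <= 4^-k / 4, and these sum up to at most 1/2. *)
Lemma leb_junction_free : (0 < leb (@junction_free R))%E.
Proof.
rewrite lt_def leb_ge0 andbT; apply/negP => /eqP g0.
pose w (k : nat) : R := (1 / 4) ^+ (2 * k + 2).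
have w0 k : 0 < w k by rewrite exprn_gt0.
pose I (k c : nat) : set R := `[c%:R / 4 ^+ k - w k, c%:R / 4 ^+ k + w k]%classic.
pose N k := \bigcup_(c in `I_(4 ^ k).+1) I k c.
have NP k : (leb (N k) <= ((1 / 2) / (2 ^ k.+1)%:R)%:E)%E.
  apply: le_trans (@leb_fin _ _ (2 * w k) _ _) _.
  - by have := w0 k; lra.
  - by move=> c _; rewrite leb_itv ?lee_fin; have := w0 k; lra.
  rewrite lee_fin -natr1 natrX; set q : R := 4 ^+ k.
  have q1 : 1 <= q by rewrite exprn_ege1// ler1n.
  have wE : w k = (16 * q ^+ 2)^-1.
    by rewrite /w exprD mulnC exprM expr_div_n expr1n -/q; field; rewrite gt_eqF//; lra.
  have two : (2 ^ k.+1)%:R = 2 * 2 ^+ k :> R by rewrite natrX exprS.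
  have p1 : 1 <= (2 : R) ^+ k by rewrite exprn_ege1// ler1n.
  have qE : q = 2 ^+ k * 2 ^+ k by rewrite /q -exprMn -natrM.
  have pq : (2 : R) ^+ k <= q by rewrite qE ler_peMl// (le_trans ler01).
  rewrite two wE.
  have -> : (1 / 2 : R) / (2 * 2 ^+ k) = (4 * 2 ^+ k)^-1 by field; rewrite gt_eqF//; lra.
  have -> : (q + 1) * (2 * (16 * q ^+ 2)^-1) = (q + 1) / (8 * q ^+ 2).
    by field; rewrite gt_eqF//; lra.
  apply: (@le_trans _ _ (4 * q)^-1); last by rewrite lef_pV2 ?posrE; lra.
  rewrite ler_pdivrMr ?mulr_gt0 ?exprn_gt0//; try lra.
  by have -> : (4 * q)^-1 * (8 * q ^+ 2) = 2 * q; [field; rewrite gt_eqF//; lra|lra].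
have cov : `[0, 1]%classic `<=` @junction_free R `|` \bigcup_k N k.
  move=> t; rewrite /= in_itv/= => /andP[t0 t1].
  have [gt|ng] := pselect (junction_free t); first by left.
  right; apply: contra_notP ng => nN; split; first by rewrite t0.
  move=> k c; rewrite leNgt; apply/negP => h; apply: nN; exists k => //.
  have q0 : 0 < (4 : R) ^+ k by rewrite exprn_gt0.
  exists c.
    rewrite /= ltnS -(ler_nat R) natrX; move: h; rewrite ltr_norml => /andP[h _].
    have h2 : c%:R / 4 ^+ k < 1 + w k by rewrite /w; lra.
    have h3 : c%:R < 4 ^+ k + w k * 4 ^+ k :> R by rewrite -[X in X + _]mul1r -mulrDl -ltr_pdivrMr.
    have h4 : w k * 4 ^+ k <= 1.
      rewrite /w expr_div_n expr1n mul1r mulrC ler_pdivrMr ?exprn_gt0// mul1r.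
      by apply: ler_weXn2l; [rewrite ler1n|lia].
    have : (c%:R < ((4 ^ k).+1)%:R :> R) by rewrite -natr1 natrX; lra.
    by rewrite ltr_nat ltnS -(ler_nat R) natrX.
  by rewrite /I /= in_itv/= -ler_distlC distrC ltW.
have : (leb `[0%R, 1%R]%classic <= (1 / 2 : R)%:E)%E.
  pose Y (i : nat) := if i is k.+1 then N k else @junction_free R.
  apply: (@le_trans _ _ (leb (\bigcup_i Y i))).
    by apply: leb_le => t /cov[gt|[k _ Nt]]; [exists 0%N|exists k.+1].
  apply: le_trans (leb_bigcup _) _.
  rewrite (@nneseries_split _ _ 0 1); last by move=> *; exact: leb_ge0.
  rewrite big_nat1 [Y 0%N]/= g0 add0e -(@nneseries_addn _ _ 1); last by move=> *; exact: leb_ge0.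
  apply: le_trans (epsilon_trick0 xpredT (_ : 0 <= 1 / 2)); last by lra.
  apply: lee_nneseries => [i _ _|i _]; first exact: leb_ge0.
  by rewrite addn1 /=; exact: NP.
by rewrite leb_itv// lee_fin; lra.
Qed.

Lemma const_growth (x B : R) : 0 < x -> exists m, B <= growth (fun=> x) m.
Proof.
move=> x0; have x20 : 0 < x ^+ 2 by rewrite exprn_gt0.
pose k := (Num.truncn (B / x ^+ 2)).+1.
exists k; rewrite growth_prod prodr_const card_ord; have kB : B / x ^+ 2 < k%:R by exact: truncnS_gt.
apply: (@le_trans _ _ (k%:R * x ^+ 2)); first by rewrite -ler_pdivrMr// ltW.
elim: (k) => [|i IH]; first by rewrite mul0r.
have h : 1 <= (1 + x ^+ 2) ^+ i by rewrite exprn_ege1// lerDl ltW.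
have -> : i.+1%:R * x ^+ 2 = i%:R * x ^+ 2 + x ^+ 2 by rewrite -natr1; ring.
rewrite (exprS _ i) [leRHS]mulrDl mul1r; apply: lerD => //.
by rewrite ler_peMr// ltW.
Qed.

Lemma const_elen (x : R) m : elen (fun=> x) m = ((1 + x ^+ 2) / 4) ^+ m.
Proof. by rewrite /elen prodr_const card_ord. Qed.

(** The dimension of a self-similar curve with four pieces of ratio r solves
    4 r^sigma = 1; here r > 1/4. *)
Lemma similarity_exponent (x : R) : 0 < x <= 1 / 1024 ->
  exists2 sigma, 1 < sigma & ((1 + x ^+ 2) / 4) `^ sigma = 1 / 4.
Proof.
move=> /andP[x0 x1]; set r := (1 + x ^+ 2) / 4.
have r4 : 1 / 4 < r by rewrite /r; nra.
have rlt1 : r < 1 by rewrite /r; nra.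
have r0 : 0 < r by lra.
have lr : ln r < 0 by apply: ln_lt0; rewrite r0.
exists (ln (1 / 4 : R) / ln r).
  by rewrite ltr_ndivlMr// [1 * ln r]mul1r ltr_ln ?posrE.
by rewrite /powR gt_eqF// mulfVK ?lt_eqF// lnK// posrE.
Qed.

(** For constant tilt, elen m to the power sigma is exactly 4^-m, so
    [curve_level] turns into a Hoelder bound of exponent sigma. *)
Lemma const_not_dim_le (x : R) (x0 : nat -> 0 < x)
  (x1 : forall k l, (k <= l)%N -> x <= x) (x2 : x <= 1 / 1024) :
  ~ dim_le R 2 1 (@snowflake R (fun=> x) x0 x1 x2).
Proof.
have [|sigma s1 rs] := @similarity_exponent x; first by rewrite x2 (x0 0%N).
have r0 : 0 <= (1 + x ^+ 2) / 4 by rewrite divr_ge0// addr_ge0// sqr_ge0.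
have s0 : 0 < sigma by apply: lt_trans s1.
apply: (@holder_not_dim_le _ _ _ _ _ sigma (4 * 2 `^ sigma)).
- exact: s1.
- by rewrite mulr_gt0// powR_gt0.
- move=> s t gs gt _; have [->|st] := eqVneq s t.
    by rewrite !subrr normr0 !mulr_ge0 ?powR_ge0.
  have [m m1 m2] := curve_level x0 x1 x2 gs gt st; apply: le_trans m1 _.
  rewrite const_elen in m2; move: ((1 + x ^+ 2) / 4) r0 rs m2 => r r0 rs m2.
  rewrite -mulrA ler_pM2l// -rs -powR_mulrn ?powR_ge0// powRAC powR_mulrn//.
  rewrite -powRM ?enorm_ge0//; apply: ge0_ler_powR; rewrite ?(ltW s0)// ?nnegrE.
  - by rewrite exprn_ge0.
  - by rewrite mulr_ge0 ?enorm_ge0.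
- exact: leb_junction_free.
Qed.

End FullMeasure.

(** * Vanishing tilt and the classification *)

Section Classification.
Variable R : realType.

Lemma harmonic_unbounded (B : R) : exists m, B <= \sum_(k < m) (k.+1%:R)^-1.
Proof.
apply: contrapT => /forallNP H; apply: (@dvg_harmonic R).
apply: nondecreasing_is_cvgn.
  move=> a b ab; rewrite /series /= (big_cat_nat (leq0n a) ab)/= lerDl.
  by apply: sumr_ge0 => i _; rewrite invr_ge0.
exists B => _ [m _ <-]; rewrite /series/= big_mkord.
by have /negP := H m; rewrite -ltNge => /ltW.
Qed.

(** The tilts tend to 0 while their squares sum to infinity. *)
Definition harmonic_tilt (k : nat) : R := 1 / 1024 * Num.sqrt (k.+1%:R)^-1.

Lemma harmonic_tilt_gt0 k : 0 < harmonic_tilt k.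
Proof. by apply: mulr_gt0; [lra|rewrite sqrtr_gt0 invr_gt0 ltr0n]. Qed.

Lemma harmonic_tilt_noninc k l : (k <= l)%N -> harmonic_tilt l <= harmonic_tilt k.
Proof.
move=> kl; have c0 : 0 < 1 / 1024 :> R by lra.
by rewrite (ler_pM2l c0) ler_sqrt ?invr_gt0 ?ltr0n// lef_pV2 ?posrE ?ltr0n// ler_nat ltnS.
Qed.

Lemma harmonic_tilt_small : harmonic_tilt 0 <= 1 / 1024.
Proof. by rewrite /harmonic_tilt invr1 sqrtr1 mulr1. Qed.

Lemma harmonic_tilt_cvg0 e : 0 < e -> exists k, harmonic_tilt k <= e.
Proof.
move=> e0; pose k := Num.truncn (e ^+ 2)^-1; exists k.
have e20 : 0 < e ^+ 2 by rewrite exprn_gt0.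
have h : (k.+1%:R)^-1 <= e ^+ 2.
  by rewrite -[leRHS]invrK lef_pV2 ?posrE ?invr_gt0 ?ltr0n// ltW// truncnS_gt.
have h2 : Num.sqrt (k.+1%:R)^-1 <= e.
  by rewrite -[leRHS](ger0_norm (ltW e0)) -sqrtr_sqr ler_sqrt ?(ltW e20).
have := sqrtr_ge0 (k.+1%:R^-1 : R); rewrite /harmonic_tilt => h3.
by apply: le_trans h2; lra.
Qed.

Lemma harmonic_growth (B : R) : exists m, B <= growth harmonic_tilt m.
Proof.
pose c : R := (1 / 1024) ^+ 2; have c0 : 0 < c by apply: exprn_gt0; lra.
have [m mP] := harmonic_unbounded (B / c); exists m.
rewrite growth_prod; apply: (@le_trans _ _ (c * \sum_(k < m) (k.+1%:R)^-1)).
  by rewrite mulrC -ler_pdivrMr.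
suff : 1 + c * \sum_(k < m) (k.+1%:R)^-1 <= \prod_(k < m) (1 + harmonic_tilt k ^+ 2).
  by apply: le_trans; rewrite lerDr.
elim: m {mP} => [|m IH]; first by rewrite !big_ord0 mulr0 addr0.
rewrite !big_ord_recr /= [X in _ * (1 + X)]exprMn sqr_sqrtr ?invr_ge0// -/c; clearbody c.
have s0 : 0 <= \sum_(i < m) (i.+1%:R : R)^-1 by apply: sumr_ge0 => i _; rewrite invr_ge0.
have i0 : 0 <= (m.+1%:R : R)^-1 by rewrite invr_ge0.
apply: le_trans (ler_wpM2r _ IH); last by rewrite addr_ge0// mulr_ge0// ltW.
rewrite mulrDl mul1r mulrDr mulrDr addrA mulr1 addrAC lerD2l.
by rewrite lerDl !mulr_ge0 ?(ltW c0).
Qed.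

Definition vanishing_snowflake :=
  snowflake harmonic_tilt_gt0 harmonic_tilt_noninc harmonic_tilt_small.

Lemma snowflake_ebounded (tau : nat -> R) (H1 : forall k, 0 < tau k)
  (H2 : forall k l, (k <= l)%N -> tau l <= tau k) (H3 : tau 0%N <= 1 / 1024) :
  ebounded (snowflake H1 H2 H3).
Proof. by apply: ebounded_eball; exact: snowflake_ball. Qed.

Definition fails_regularity (A : set 'rV[R]_2) :=
  [/\ ~ weakly_locally_finite R 2 1 A, ~ strongly_locally_finite R 2 1 A &
      ~ rectifiable R 2 1 A].

Lemma snowflake_fails (tau : nat -> R) (H1 : forall k, 0 < tau k)
  (H2 : forall k l, (k <= l)%N -> tau l <= tau k) (H3 : tau 0%N <= 1 / 1024) :
  (forall B, exists m, B <= growth tau m) -> fails_regularity (snowflake H1 H2 H3).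
Proof.
move=> G; have E := curve_expanding H1 H2 H3 G; have L := leb_junction_free R.
split; [exact: expanding_not_weakly| |exact: expanding_not_rectifiable].
by apply: expanding_not_strongly => //; exact: snowflake_ebounded.
Qed.

Lemma wrhoj_wj gamma n j (A : set 'rV[R]_n) : wrhoj gamma n j A -> wj gamma n j A.
Proof.
move=> H y Ay; have [r r0 rP] := H y Ay; exists r => // rho rr.
by apply: rP => //; split => //; rewrite /eball/= subrr enorm0.
Qed.

Lemma wrho0j_wrhoj gamma n j (A : set 'rV[R]_n) : wrho0j gamma n j A -> wrhoj gamma n j A.
Proof. by move=> [r [r0 _ rP]] y Ay; exists r => // rho rr x [_ Ax]; exact: rP. Qed.

Lemma srhoj_sj gamma n j (A : set 'rV[R]_n) : srhoj gamma n j A -> sj gamma n j A.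
Proof.
move=> H y Ay; have [r r0 [L dL rP]] := H y Ay; exists r => //; exists L => // rho rr.
by apply: rP => //; split => //; rewrite /eball/= subrr enorm0.
Qed.

Lemma srho0j_srhoj gamma n j (A : set 'rV[R]_n) : srho0j gamma n j A -> srhoj gamma n j A.
Proof.
by move=> [r [r0 _ [L dL rP]]] y Ay; exists r => //; exists L => // x [_ Ax] rho; exact: rP.
Qed.

Lemma half01 : 0 < (1 / 2 : R) < 1. Proof. by lra. Qed.

Lemma answers_no (P Q : set_prop R) (A : set 'rV[R]_2) :
  P 2%N 1%N A -> ~ Q 2%N 1%N A -> answers P Q No.
Proof. by move=> PA QA; exists 2%N, 1%N; split => //; exists A. Qed.

(** w rho_0 j implies the two other properties, so one curve with constant tilt
    refutes everything. *)
Lemma classified_w (gamma : R) : 0 < gamma < 1 ->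
  [/\ classified (wj gamma) No No No No, classified (wrhoj gamma) No No No No
    & classified (wrho0j gamma) No No No No].
Proof.
move=> /andP[g0 g1]; pose x := gamma / 1024.
have x01 : 0 < x <= 1 / 1024 by rewrite /x; lra.
have [x0 x1] := andP x01.
pose A := snowflake (fun=> x0) (fun k l (_ : (k <= l)%N) => lexx x) x1.
have A3 : wrho0j gamma 2 1 A by apply: snowflake_wrho0j; rewrite /x; lra.
have [Aw As Ar] : fails_regularity A by apply: snowflake_fails => B; exact: const_growth.
have Ad : ~ dim_le R 2 1 A by exact: const_not_dim_le.
have A2 := wrho0j_wrhoj A3; have A1 := wrhoj_wj A2.
by split; split; apply: answers_no; eassumption.
Qed.

Lemma classified_wdelta : [/\ classified (wdeltaj R) Yes No No No,
  classified (wrhodeltaj R) Yes No No No & classified (wrho0deltaj R) Yes Yes Yes Yes].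
Proof.
have A2 : wrhodeltaj R 2 1 vanishing_snowflake.
  by apply: snowflake_wrhodeltaj; exact: harmonic_tilt_cvg0.
have A1 : wdeltaj R 2 1 vanishing_snowflake by move=> g /A2; exact: wrhoj_wj.
have [Aw As Ar] : fails_regularity vanishing_snowflake.
  by apply: snowflake_fails; exact: harmonic_growth.
split; split; try by apply: answers_no; eassumption.
- by move=> n j _ A; exact: wdeltaj_dim.
- by move=> n j _ A H; apply: wdeltaj_dim => g /H; exact: wrhoj_wj.
- by move=> n j _ A /wrho0deltaj_minkowski; exact: minkowski_dim.
- by move=> n j _ A /wrho0deltaj_minkowski; exact: minkowski_weakly.
- by move=> n j _ A /wrho0deltaj_minkowski; exact: minkowski_strongly.
- by move=> n j _ A; exact: wrho0deltaj_rectifiable.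
Qed.

Lemma classified_s (gamma : R) : 0 < gamma < 1 ->
  [/\ classified (sj gamma) Yes No No Yes, classified (srhoj gamma) Yes Yes No Yes
    & classified (srho0j gamma) Yes Yes Yes Yes].
Proof.
move=> g01.
have S0 : sj gamma 2 1 (0 |` @stripes R) by exact: stripes0_sdelta.
have S1 : srhoj gamma 2 1 (@stripes R) by exact: stripes_srhodelta.
have strong0 : ~ strongly_locally_finite R 2 1 (0 |` @stripes R).
  by apply: stripes_not_strongly => z; right.
have strong1 : ~ strongly_locally_finite R 2 1 (@stripes R).
  exact: stripes_not_strongly.
have weak0 := @stripes0_not_weakly R.
split; split; try by apply: answers_no; eassumption.
- by move=> n j _ A; exact: sj_dim.
- by move=> n j _ A; exact: sj_rectifiable.
- by move=> n j _ A /srhoj_sj; exact: sj_dim.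
- by move=> n j _ A; exact: srhoj_weakly.
- by move=> n j _ A /srhoj_sj; exact: sj_rectifiable.
- by move=> n j _ A /(srho0j_minkowski g01); exact: minkowski_dim.
- by move=> n j _ A /(srho0j_minkowski g01); exact: minkowski_weakly.
- by move=> n j _ A /(srho0j_minkowski g01); exact: minkowski_strongly.
- by move=> n j _ A /srho0j_srhoj/srhoj_sj; exact: sj_rectifiable.
Qed.

Lemma classified_sdelta : [/\ classified (sdeltaj R) Yes No No Yes,
  classified (srhodeltaj R) Yes Yes No Yes & classified (srho0deltaj R) Yes Yes Yes Yes].
Proof.
have S0 := @stripes0_sdelta R; have S1 := @stripes_srhodelta R.
have strong0 : ~ strongly_locally_finite R 2 1 (0 |` @stripes R).
  by apply: stripes_not_strongly => z; right.
have strong1 : ~ strongly_locally_finite R 2 1 (@stripes R).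
  exact: stripes_not_strongly.
have weak0 := @stripes0_not_weakly R.
have [[d1 _ _ r1] [d2 w2 _ r2] [d3 w3 s3 r3]] := classified_s half01.
split; split; try by apply: answers_no; eassumption.
all: by move=> n j jn A /(_ _ half01); auto.
Qed.

End Classification.

Theorem theorem2p8 (R : realType) :
  (forall gamma : R, 0 < gamma < 1 ->
    classified (wj gamma) No No No No /\
    classified (wrhoj gamma) No No No No /\
    classified (wrho0j gamma) No No No No) /\
  (classified (wdeltaj R) Yes No No No /\
   classified (wrhodeltaj R) Yes No No No /\
   classified (wrho0deltaj R) Yes Yes Yes Yes) /\
  (forall gamma : R, 0 < gamma < 1 ->
    classified (sj gamma) Yes No No Yes /\
    classified (srhoj gamma) Yes Yes No Yes /\
    classified (srho0j gamma) Yes Yes Yes Yes) /\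
  (classified (sdeltaj R) Yes No No Yes /\
   classified (srhodeltaj R) Yes Yes No Yes /\
   classified (srho0deltaj R) Yes Yes Yes Yes).
Proof.
split; last split; last split.
- by move=> gamma /classified_w[].
- by have [] := classified_wdelta R.
- by move=> gamma /classified_s[].
- by have [] := classified_sdelta R.
Qed.
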